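(* Let $r\ge 2$ be an integer, $q$ complex with $|q|<1$, and $z$ a nonzero complex number such that no denominator below vanishes. Then \begin{equation*} \sum_{k\in\Lambda^{r-1}}\frac{q^{\sum_{j=1}^{r-1}k_j^2}\,z^{\sum_{j=1}^{r-1} k_j}}{(zq^2;q^2)_{k_{r-1}}\prod_{j=1}^{r-2}(q;q)_{k_j-k_{j+1}}} =\frac{(q;q^2)_\infty(z^rq^r,z^{-r}q^r,q^{2r};q^{2r})_\infty}{(zq;q)_\infty(q/z;q^2)_\infty}. \end{equation*}
   Context: For complex $x$ and $k\in\mathbb Z\cup\{\infty\}$ the $q$-shifted factorial is $(x;q)_0=1$, $(x;q)_k=\prod_{j=1}^k(1-xq^{j-1})$ for $k>0$ (including $k=\infty$), and $(x;q)_k=\prod_{j=1}^{-k}(1-xq^{-j})^{-1}$ for $k<0$; $(x_1,\dots,x_m;q)_k=\prod_l(x_l;q)_k$. For $r\ge2$, $k=(k_1,\dots,k_{r-1})$ and $\Lambda^{r-1}=\{k\in\mathbb Z^{r-1}:\infty>k_1\ge\dots\ge k_{r-1}>-\infty\}$. Empty products are $1$. *)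

(* Defs.v *)
From HB Require Import structures.
From mathcomp Require Export all_boot all_order all_algebra.
From mathcomp Require Export complex.
From mathcomp Require Export all_classical all_reals all_analysis.
From mathcomp.analysis.showcase Require Export summability.

Set Implicit Arguments.
Unset Strict Implicit.
Unset Printing Implicit Defensive.

Import Order.TTheory GRing.Theory Num.Theory.
Import numFieldNormedType.Exports.

Local Open Scope classical_set_scope.
Local Open Scope ring_scope.
Local Open Scope complex_scope.

(* (x; q)_k for finite k. For k < 0, if some factor 1 - x q^(-j) vanishes then
   (x; q)_k has a pole; since 0^-1 = 0 here, the value is then 0 and so is
   (qpoch x q k)^-1, in agreement with the usual reading
   1 / (x; q)_k = \prod_(1 <= j <= -k) (1 - x q^(-j)) = 0. *)
Definition qpoch (R : realType) (x q : R[i]) (k : int) : R[i] :=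
  match k with
  | Posz n => \prod_(1 <= j < n.+1) (1 - x * q ^+ j.-1)
  | Negz n => \prod_(1 <= j < n.+2) (1 - x * q ^- j)^-1
  end.

(* The limit is taken in R[i]^o because the topology of the modulus is attached
   to R[i] viewed as a normed module over itself. *)
Definition qpoch_infty (R : realType) (x q : R[i]) : R[i] :=
  lim ((fun n : nat => qpoch x q n : R[i]^o) @ \oo).

Definition qpochs_infty (R : realType) (xs : seq R[i]) (q : R[i]) : R[i] :=
  \prod_(x <- xs) qpoch_infty x q.

Definition Lambda (n : nat) := {k : n.-tuple int | sorted >=%R k}.

(* k_j, numbered from 1. *)
Definition entry (n : nat) (k : Lambda n) (j : nat) : int := (val k)`_(j.-1).

(* Main.v *)
(** Write [F y = (y; q)_oo], [G y = (y; q^2)_oo] and [w k = q^(k^2) z^k].  The proof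
is the Bailey chain with all indices running over the integers.  Lebesgue's
identity gives the bilateral Bailey pair
[1 / (zq^2; q^2)_N = G q / G (q/z) * sum_j (-1)^j w j / ((q; q)_(N-j) (zq; q)_(N+j))].
After inserting it in the left-hand side, the sums over [k_(r-1), ..., k_2] are
q-Chu-Vandermonde sums and the sum over [k_1] is the limiting case; each of them
contributes a factor [w j].  There remains [sum_j (-1)^j (w j)^r], which the Jacobi
triple product evaluates.

Reciprocals are extended to all integers by [1 / (x; q)_k = F (x q^k) / F x], so that
[1 / (q; q)_k = 0] for [k < 0] and the ordering of the indices is automatic.  Every
infinite sum involved has an explicit value: the interchanges of summation and the
passages to the limit only need the terms to be dominated, with
[rho = |q|^(1/2)], by a constant times the product of the [rho^|k_i|]. *)

Require Import Defs.
From mathcomp Require Import finmap ring lra zify.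

Import Order.TTheory GRing.Theory Num.Theory.
Import numFieldNormedType.Exports.

Set Implicit Arguments.
Unset Strict Implicit.
Unset Printing Implicit Defensive.

Local Open Scope classical_set_scope.
Local Open Scope ring_scope.
Local Open Scope complex_scope.

Local Notation nm := (@ComplexField.Normc.normc _).

(** * The real-valued modulus on [R[i]], and convergence tested with it *)

Section Modulus.
Variable R : realType.
Implicit Types x y : R[i].

Lemma nmE x : `|x| = (nm x)%:C. Proof. by []. Qed.

Lemma nm_ge0 x : 0 <= nm x.
Proof. by rewrite -(@lecR R) -nmE rmorph0 normr_ge0. Qed.

Lemma nm_eq0 x : (nm x == 0) = (x == 0).
Proof.
apply/eqP/eqP => [/ComplexField.Normc.eq0_normc //|->].
exact: ComplexField.Normc.normc0.
Qed.

Lemma nm0 : nm (0 : R[i]) = 0. Proof. exact: ComplexField.Normc.normc0. Qed.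
Lemma nm1 : nm (1 : R[i]) = 1. Proof. exact: ComplexField.Normc.normc1. Qed.

Lemma nmM x y : nm (x * y) = nm x * nm y.
Proof. exact: ComplexField.Normc.normcM. Qed.

Lemma nmV x : nm x^-1 = (nm x)^-1.
Proof. exact: ComplexField.Normc.normcV. Qed.

Lemma nmN x : nm (- x) = nm x. Proof. exact: (@normcN R). Qed.

Lemma nmD x y : nm (x + y) <= nm x + nm y. Proof. exact: (@le_normcD R). Qed.

Lemma nmB x y : nm (x - y) <= nm x + nm y.
Proof. by rewrite -[in leRHS](nmN y) nmD. Qed.

Lemma nmBC x y : nm (x - y) = nm (y - x).
Proof. by rewrite -nmN opprB. Qed.

Lemma nmX x n : nm (x ^+ n) = nm x ^+ n.
Proof. by elim: n => [|n IHn]; rewrite ?expr0 ?nm1 // !exprS nmM IHn. Qed.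

Lemma nmXz x (k : int) : nm (x ^ k) = nm x ^ k.
Proof. by case: k => n; rewrite ?NegzE -?exprnN ?nmV nmX // exprnN. Qed.

Lemma nmXN1 (k : int) : nm ((-1 : R[i]) ^ k) = 1.
Proof. by rewrite nmXz nmN nm1 exp1rz. Qed.

Lemma nm_gt0 x : (0 < nm x) = (x != 0).
Proof. by rewrite lt_def nm_ge0 nm_eq0 andbT. Qed.

Lemma nm_leM x y (a b : R) : nm x <= a -> nm y <= b -> nm (x * y) <= a * b.
Proof. by move=> xa yb; rewrite nmM ler_pM ?nm_ge0. Qed.

Lemma nm_sum (I : Type) (s : seq I) (P : pred I) (f : I -> R[i]) :
  nm (\sum_(i <- s | P i) f i) <= \sum_(i <- s | P i) nm (f i).
Proof.
apply: (big_ind2 (fun x c => nm x <= c)) => [|x a y b xa yb|//].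
  by rewrite nm0.
by rewrite (le_trans (nmD _ _)) ?lerD.
Qed.

(** A positive element of [R[i]] has zero imaginary part, so real tolerances suffice in the
    definition of the limit. *)
Lemma nm_cvgP (T : Type) (F : set_system T) {FF : Filter F}
    (f : T -> R[i]) (l : R[i]) :
  ((f : T -> R[i]^o) @ F --> (l : R[i]^o)) <->
  forall e : R, 0 < e -> \forall x \near F, nm (l - f x) <= e.
Proof.
split=> [/cvgrPdist_le fl e e0|fl].
  have := fl e%:C; rewrite ltcR => /(_ e0); apply: filterS => x /=.
  by rewrite nmE lecR.
apply/cvgrPdist_le => -[a b]; rewrite ltcE /= => /andP[/eqP -> a0].
by apply: filterS (fl a a0) => x ?; rewrite nmE lecR.
Qed.

Lemma cvg_bounded (u : nat -> R[i]) (l : R[i]) :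
  (u : nat -> R[i]^o) @ \oo --> (l : R[i]^o) ->
  exists c : R, 0 < c /\ forall n, nm (u n) <= c.
Proof.
move=> /nm_cvgP /(_ _ ltr01)[N _ uN].
exists (nm l + 1 + \sum_(i < N) nm (u i)); split.
  have := nm_ge0 l; have : 0 <= \sum_(i < N) nm (u i).
    by apply: sumr_ge0 => i _; exact: nm_ge0.
  lra.
move=> n; have [nN|Nn] := ltnP n N.
  rewrite (bigD1 (Ordinal nN)) //=; have := nm_ge0 l.
  have : 0 <= \sum_(i < N | i != Ordinal nN) nm (u i).
    by apply: sumr_ge0 => i _; exact: nm_ge0.
  lra.
have := uN n Nn; have := nmB l (l - u n); rewrite /= subKr.
have : 0 <= \sum_(i < N) nm (u i).
  by apply: sumr_ge0 => i _; exact: nm_ge0.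
lra.
Qed.

End Modulus.

(** * Unconditional summation *)

#[local] Existing Instance totally_filter.

Section Summation.
Variable R : realType.

(** The limit runs along finite subsets ordered by inclusion, so no enumeration of the integers or
    of the tuples has to be chosen. *)
Definition hsum (T : choiceType) (f : T -> R[i]) (s : R[i]) :=
  partial_sum (f : T -> R[i]^o) @ totally --> (s : R[i]^o).

(* For nonnegative [g] this is summability. *)
Definition bsum (T : choiceType) (g : T -> R) :=
  exists M : R, forall A : {fset T}, \sum_(i <- A) g i <= M.

Lemma partial_sumE (T : choiceType) (V : zmodType) (f : T -> V) (A : {fset T}) :
  partial_sum f A = \sum_(i <- A) f i.
Proof. by rewrite /partial_sum big_seq_fsetE. Qed.

Lemma hsumE (T : choiceType) (f : T -> R[i]) s :
  hsum f s =
  ((fun A : {fset T} => \sum_(i <- A) f i : R[i]^o) @ totally --> (s : R[i]^o)).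
Proof. by rewrite /hsum (funext (partial_sumE _)). Qed.

Lemma hsumP (T : choiceType) (f : T -> R[i]) s :
  hsum f s <-> forall e : R, 0 < e -> exists A0 : {fset T},
    forall A : {fset T}, (A0 `<=` A)%fset -> nm (s - \sum_(i <- A) f i) <= e.
Proof.
rewrite /hsum nm_cvgP; split=> fs e /fs [A0].
  by move=> _ A0P; exists A0 => A /A0P /=; rewrite partial_sumE.
by move=> A0P; exists A0 => // A /A0P /=; rewrite partial_sumE.
Qed.

Lemma hsum_ext (T : choiceType) (f g : T -> R[i]) s : f =1 g -> hsum f s -> hsum g s.
Proof. by move=> /funext ->. Qed.

Lemma hsumZ (T : choiceType) (f : T -> R[i]) c s :
  hsum f s -> hsum (fun i => c * f i) (c * s).
Proof.
rewrite /hsum => fs.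
rewrite (_ : partial_sum _ = (fun A => c * partial_sum f A)); last first.
  by apply/funext => A; rewrite !partial_sumE mulr_sumr.
exact: cvgM (@cvg_cst R[i]^o c _ totally _) fs.
Qed.

Lemma hsumD (T : choiceType) (f g : T -> R[i]) s t :
  hsum f s -> hsum g t -> hsum (fun i => f i + g i) (s + t).
Proof.
rewrite /hsum => fs gt.
rewrite (_ : partial_sum _ = (fun A => partial_sum f A + partial_sum g A)).
  exact: (cvgD fs gt).
by apply/funext => A; rewrite !partial_sumE big_split.
Qed.

Lemma hsum_fin (T : choiceType) (f : T -> R[i]) (A0 : {fset T}) :
  (forall i, i \notin A0 -> f i = 0) -> hsum f (\sum_(i <- A0) f i).
Proof.
move=> f0; apply/hsumP => e e0; exists A0 => A A0A.
rewrite (@big_fset_incl _ _ _ _ A0 A) // => [|i _ /f0 //].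
by rewrite subrr nm0 ltW.
Qed.

Lemma sum_fset_iota (V : zmodType) (f : nat -> V) n :
  \sum_(i <- seq_fset tt (iota 0 n)) f i = \sum_(0 <= i < n) f i.
Proof.
rewrite /index_iota subn0; apply: perm_big.
by rewrite -[X in perm_eq _ X](undup_id (iota_uniq 0 n)) seq_fset_perm.
Qed.

Lemma hsum_nat (f : nat -> R[i]) n :
  (forall i, (n <= i)%N -> f i = 0) -> hsum f (\sum_(0 <= i < n) f i).
Proof.
move=> f0; rewrite -sum_fset_iota; apply: hsum_fin => i.
rewrite seq_fsetE mem_iota /= add0n -leqNgt.
exact: f0.
Qed.

Lemma sum_imfset (S T : choiceType) (V : zmodType) (h : S -> T) (f : T -> V)
    (A : {fset S}) : injective h ->
  \sum_(t <- (h @` A)%fset) f t = \sum_(i <- A) f (h i).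
Proof. by move=> h_inj; rewrite big_imfset //= => ? ? _ _; exact: h_inj. Qed.

(** Off the range of [h] the terms vanish, so finite sets can be moved through [h] by image and
    preimage without changing the sums. This covers both re-indexing and extension by zero. *)
Lemma hsum_inj (S T : choiceType) (h : S -> T) (f : T -> R[i]) s :
  injective h -> (forall t, f t != 0 -> exists x, t = h x) ->
  hsum f s <-> hsum (fun x => f (h x)) s.
Proof.
move=> h_inj f0.
(* A partial inverse of [h]: [pmap hinv] computes the finite preimage of a finite set. *)
pose hinv t := if pselect (exists x, t = h x) is left tx then Some (projT1 (cid tx))
  else None.
rewrite !hsumP; split=> fs e /fs [A0 A0P].
  pose B0 := [fset x | x in pmap hinv A0]%fset.
  have hB0 t : t \in A0 -> (exists x, t = h x) -> exists2 x, x \in B0 & t = h x.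
    move=> tA0 ext; case: (cid ext) => x tx; exists x => //.
    rewrite !inE /= mem_pmap; apply/mapP; exists t => //.
    rewrite /hinv; case: pselect => // e'; congr Some; apply: h_inj.
    by rewrite -(projT2 (cid e')).
  exists B0 => B B0B.
  have -> : \sum_(i <- B) f (h i) = \sum_(t <- (A0 `|` (h @` B))%fset) f t.
    rewrite -(sum_imfset _ _ h_inj).
    apply: big_fset_incl; first exact: fsubsetUr.
    move=> t; rewrite inE => /orP[tA0 tB|-> //].
    apply/eqP/negPn/negP => /f0 ext.
    have [x xB0 tx] := hB0 t tA0 ext.
    move: tB; rewrite tx => /negP; apply; apply/imfsetP; exists x => //=.
    exact: (fsubsetP B0B).
  by apply: A0P; exact: fsubsetUl.
exists (h @` A0)%fset => A hA.
pose B := [fset x | x in pmap hinv A]%fset.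
have inB x : (x \in B) = (h x \in A).
  rewrite !inE /= mem_pmap; apply/mapP/idP => [[t tA]|hxA].
    by rewrite /hinv; case: pselect => // e' [->]; rewrite -(projT2 (cid e')).
  exists (h x) => //; rewrite /hinv; case: pselect => [e'|[]]; last by exists x.
  by congr Some; apply: h_inj; rewrite -(projT2 (cid e')).
have -> : \sum_(t <- A) f t = \sum_(i <- B) f (h i).
  rewrite -(sum_imfset _ _ h_inj).
  apply/esym/big_fset_incl.
    by apply/fsubsetP => t /imfsetP[x /= + ->]; rewrite inB.
  move=> t tA tB; apply/eqP/negPn/negP => /f0 [x tx].
  by move/negP: tB; apply; apply/imfsetP; exists x => //=; rewrite inB -tx.
apply: A0P; apply/fsubsetP => x xA0; rewrite inB.
by apply: (fsubsetP hA); apply/imfsetP; exists x.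
Qed.

Lemma hsum_from_inj (S T : choiceType) (h : S -> T) (f : T -> R[i]) s :
  injective h -> (forall t, f t != 0 -> exists x, t = h x) ->
  hsum (fun x => f (h x)) s -> hsum f s.
Proof. by move=> h_inj f0; apply: (hsum_inj s h_inj f0).2. Qed.

Lemma ler_sum_fset (T : choiceType) (g : T -> R) (A B : {fset T}) :
  (forall i, 0 <= g i) -> (A `<=` B)%fset ->
  \sum_(i <- A) g i <= \sum_(i <- B) g i.
Proof.
move=> g0 AB; rewrite [leRHS](big_fsetID _ (mem A)) /=.
rewrite (_ : [fset x in B | x \in A]%fset = A) ?lerDl ?sumr_ge0 //.
by apply/fsetP => x; rewrite !inE /= -in_fsetI (fsetIidPr _).
Qed.

(** A finite sum within [e] of the supremum of all finite sums leaves at most [e] for the remaining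
    terms. *)
Lemma bsum_tail (T : choiceType) (g : T -> R) (e : R) :
  (forall i, 0 <= g i) -> bsum g -> 0 < e ->
  exists A0 : {fset T}, forall A B : {fset T}, (A0 `<=` A)%fset ->
    (A `<=` B)%fset -> \sum_(i <- B) g i - \sum_(i <- A) g i <= e.
Proof.
move=> g0 [M gM] e0.
pose S : set R := [set x | exists A : {fset T}, x = \sum_(i <- A) g i].
have supS : has_sup S.
  split; first by exists (\sum_(i <- fset0) g i); exists fset0.
  by exists M => _ [A ->].
have [_ [A0 ->] A0e] := sup_adherent e0 supS.
exists A0 => A B A0A AB.
have : \sum_(i <- B) g i <= sup S by apply: sup_upper_bound => //; exists B.
have := ler_sum_fset g0 A0A; lra.
Qed.

(** [A0] is chosen from [g] alone, before [f] is given. This uniformity is what [tannery] needs,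
    where the index [n] of [f n] is fixed only after the finite set. *)
Lemma dominated_tail (T : choiceType) (g : T -> R) (e : R) :
  (forall i, 0 <= g i) -> bsum g -> 0 < e ->
  exists A0 : {fset T}, forall A B : {fset T}, (A0 `<=` A)%fset ->
    (A `<=` B)%fset -> forall f : T -> R[i], (forall i, nm (f i) <= g i) ->
    nm (\sum_(i <- B) f i - \sum_(i <- A) f i) <= e.
Proof.
move=> g0 gb e0; have [A0 A0P] := bsum_tail g0 gb e0.
exists A0 => A B A0A AB f fg; apply: le_trans (A0P _ _ A0A AB).
have decomp (V : zmodType) (h : T -> V) : \sum_(i <- B) h i - \sum_(i <- A) h i =
    \sum_(i <- [fset x in B | x \notin A]%fset) h i.
  have BA : [fset x in B | x \in A]%fset = A.
    by apply/fsetP => x; rewrite !inE /= -in_fsetI (fsetIidPr _).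
  by rewrite (big_fsetID _ (mem A) B) /= BA addrAC subrr add0r.
rewrite !decomp (le_trans (nm_sum _ _ _)) //; exact: ler_sum.
Qed.

Lemma cvg_finsum (T : choiceType) (D : Type) (F : set_system D) {FF : Filter F}
    (f : D -> T -> R[i]) (g : T -> R[i]) (A : {fset T}) :
  (forall i, (fun n => f n i : R[i]^o) @ F --> (g i : R[i]^o)) ->
  (fun n => \sum_(i <- A) f n i : R[i]^o) @ F --> (\sum_(i <- A) g i : R[i]^o).
Proof.
move=> fg; elim: (A : seq T) => [|a s IHs].
  by rewrite big_nil; under eq_fun do rewrite big_nil; exact: cvg_cst.
rewrite big_cons; under eq_fun do rewrite big_cons.
exact: cvgD (fg a) IHs.
Qed.

Arguments cvg_finsum {T D F FF f g} A _.

(* The values [s n] are part of the hypotheses, so that completeness of [R[i]] is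
   not used. *)
Lemma tannery (T : choiceType) (f : nat -> T -> R[i]) (h : T -> R[i]) (g : T -> R)
    (s : nat -> R[i]) (t : R[i]) :
  bsum g -> (forall n i, nm (f n i) <= g i) ->
  (forall n, hsum (f n) (s n)) ->
  (forall i, (fun n => f n i : R[i]^o) @ \oo --> (h i : R[i]^o)) ->
  (s : nat -> R[i]^o) @ \oo --> (t : R[i]^o) -> hsum h t.
Proof.
move=> gb fg fs fh st; apply/hsumP => e e0.
have g0 i : 0 <= g i := le_trans (nm_ge0 _) (fg 0%N i).
(* Four errors: [t] against [s n], [s n] against a large finite sum of [f n], that sum against its
   part over [A], and [f n] against [h] on [A]. *)
have e40 : 0 < e / 4 by rewrite divr_gt0.
have [A0 A0P] := dominated_tail g0 gb e40.
exists A0 => A A0A.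
move/nm_cvgP/(_ _ e40): st => [N1 _ N1P].
have [N2 _ N2P] := (nm_cvgP _ _).1 (cvg_finsum A fh) _ e40.
pose n := maxn N1 N2.
have := N1P n (leq_maxl _ _); have := N2P n (leq_maxr _ _) => /= hA hs.
have /hsumP/(_ _ e40)[B0 B0P] := fs n.
have := B0P _ (fsubsetUl B0 A) => hB.
have := A0P _ _ A0A (fsubsetUr B0 A) _ (fg n) => hAB.
set a := \sum_(i <- A) h i in hA *; set b := \sum_(i <- A) f n i in hA hAB.
set c := \sum_(i <- _) _ in hB hAB.
have -> : t - a = (t - s n) + ((s n - c) + ((c - b) + (b - a))) by ring.
have := nmD (t - s n) ((s n - c) + ((c - b) + (b - a))).
have := nmD (s n - c) ((c - b) + (b - a)).
have := nmD (c - b) (b - a); have := nmBC a b; lra.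
Qed.

Lemma big_fsetM (S T : choiceType) (V : zmodType) (f : S * T -> V)
    (A : {fset S}) (B : {fset T}) :
  \sum_(p <- (A `*` B)%fset) f p = \sum_(i <- A) \sum_(j <- B) f (i, j).
Proof.
by rewrite big_imfset2 //= => -[i j] [i' j'] _ _ /= [-> ->].
Qed.

(** Over a finite set [A] of rows, the row sums are approximated by the sum over a rectangle
    [A * J]; for [J] large the rectangle contains [A0] and its sum is close to [s]. *)
Lemma fubini_outer (S T : choiceType) (f : S * T -> R[i]) (g : S -> R[i]) s :
  hsum f s -> (forall i, hsum (fun j => f (i, j)) (g i)) -> hsum g s.
Proof.
move=> fs fg; apply/hsumP => e e0; have e20 : 0 < e / 2 by rewrite divr_gt0.
move/hsumP/(_ _ e20): fs => [A0 A0P].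
exists [fset p.1 | p in A0]%fset => A A0A.
have fgp i : (fun J : {fset T} => \sum_(j <- J) f (i, j) : R[i]^o) @ totally
    --> (g i : R[i]^o).
  by rewrite -hsumE; exact: fg.
have [J0 _ J0P] := (nm_cvgP _ _).1 (cvg_finsum A fgp) _ e20.
pose J := (J0 `|` [fset p.2 | p in A0])%fset.
have := J0P J (fsubsetUl _ _) => /=; rewrite -big_fsetM => hJ.
have /A0P : (A0 `<=` A `*` J)%fset.
  apply/fsubsetP => p pA0; rewrite inE; apply/andP; split.
    by apply: (fsubsetP A0A); apply/imfsetP; exists p.
  by apply: (fsubsetP (fsubsetUr J0 _)); apply/imfsetP; exists p.
set a := \sum_(i <- A) _ in hJ *; set b := \sum_(i <- _) _ in hJ *.
have -> : s - a = (s - b) + (b - a) by ring.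
have := nmD (s - b) (b - a); have := nmBC a b; lra.
Qed.

(** Here an arbitrary finite set [A] of pairs has to be compared with a rectangle [I * J] containing
    it; the domination by [m] controls the difference. *)
Lemma fubini_total (S T : choiceType) (f : S * T -> R[i]) (g : S -> R[i])
    (m : S * T -> R) s :
  bsum m -> (forall p, nm (f p) <= m p) ->
  (forall i, hsum (fun j => f (i, j)) (g i)) -> hsum g s -> hsum f s.
Proof.
move=> mb fm fg gs; apply/hsumP => e e0; have e30 : 0 < e / 3 by rewrite divr_gt0.
have m0 i : 0 <= m i := le_trans (nm_ge0 _) (fm i).
have [A0 A0P] := dominated_tail m0 mb e30.
exists A0 => A A0A.
move/hsumP/(_ _ e30): gs => [I0 I0P].
pose I := (I0 `|` [fset p.1 | p in A])%fset.
have := I0P I (fsubsetUl _ _) => hI.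
have fgp i : (fun J : {fset T} => \sum_(j <- J) f (i, j) : R[i]^o) @ totally
    --> (g i : R[i]^o).
  by rewrite -hsumE; exact: fg.
have [J0 _ J0P] := (nm_cvgP _ _).1 (cvg_finsum I fgp) _ e30.
pose J := (J0 `|` [fset p.2 | p in A])%fset.
have := J0P J (fsubsetUl _ _) => /=; rewrite -big_fsetM => hJ.
have AIJ : (A `<=` I `*` J)%fset.
  apply/fsubsetP => p pA; rewrite inE; apply/andP; split.
    by apply: (fsubsetP (fsubsetUr I0 _)); apply/imfsetP; exists p.
  by apply: (fsubsetP (fsubsetUr J0 _)); apply/imfsetP; exists p.
have := A0P _ _ A0A AIJ _ fm => hA.
set a := \sum_(i <- I) _ in hI hJ; set b := \sum_(i <- _) _ in hJ hA.
set c := \sum_(i <- A) _ in hA *.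
have -> : s - c = (s - a) + ((a - b) + (b - c)) by ring.
have := nmD (s - a) ((a - b) + (b - c)); have := nmD (a - b) (b - c); lra.
Qed.

Lemma bsum_le (T : choiceType) (g h : T -> R) :
  (forall i, g i <= h i) -> bsum h -> bsum g.
Proof.
by move=> gh [M hM]; exists M => A; apply: le_trans (hM A); exact: ler_sum.
Qed.

Lemma bsumZ (T : choiceType) (g : T -> R) c :
  0 <= c -> bsum g -> bsum (fun i => c * g i).
Proof.
by move=> c0 [M gM]; exists (c * M) => A; rewrite -mulr_sumr ler_wpM2l.
Qed.

Lemma bsum_inj (S T : choiceType) (h : S -> T) (g : T -> R) :
  injective h -> bsum g -> bsum (fun x => g (h x)).
Proof.
move=> h_inj [M gM]; exists M => A.
rewrite -(sum_imfset _ _ h_inj).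
exact: gM.
Qed.

Lemma bsum_prod (S T : choiceType) (g : S -> R) (h : T -> R) :
  (forall i, 0 <= g i) -> (forall i, 0 <= h i) -> bsum g -> bsum h ->
  bsum (fun p : S * T => g p.1 * h p.2).
Proof.
move=> g0 h0 [M gM] [N hN]; exists (M * N) => A.
pose I := [fset p.1 | p in A]%fset; pose J := [fset p.2 | p in A]%fset.
apply: (@le_trans _ _ (\sum_(p <- (I `*` J)%fset) g p.1 * h p.2)).
  apply: ler_sum_fset => [p|]; first by rewrite mulr_ge0.
  by apply/fsubsetP => p pA; rewrite inE; apply/andP; split;
    apply/imfsetP; exists p.
rewrite big_fsetM /=; under eq_bigr do rewrite -mulr_sumr.
by rewrite -mulr_suml ler_pM // sumr_ge0.
Qed.

Lemma bsum_geom (rho : R) : 0 <= rho < 1 -> bsum (fun n : nat => rho ^+ n).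
Proof.
move=> /andP[r0 r1]; exists (1 - rho)^-1 => A.
pose n := (\max_(i <- A) i).+1; pose B : {fset nat} := seq_fset tt (iota 0 n).
apply: (@le_trans _ _ (\sum_(i <- B) rho ^+ i)).
  apply: ler_sum_fset => [i|]; first exact: exprn_ge0.
  apply/fsubsetP => i iA; rewrite seq_fsetE mem_iota /= add0n ltnS.
  by apply: leq_bigmax_seq.
rewrite sum_fset_iota; have r10 : 0 < 1 - rho by lra.
rewrite -(ler_pM2l r10) mulfV ?gt_eqF // big_mkord.
rewrite -(opprB rho 1) mulNr -subrX1 opprB gerBl; exact: exprn_ge0.
Qed.

Lemma bsum_geom_int (rho : R) : 0 <= rho < 1 -> bsum (fun k : int => rho ^+ `|k|%N).
Proof.
move=> r01; have r0 : 0 <= rho by case/andP: r01.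
(* An integer is encoded injectively by its absolute value and a sign bit, which reduces the claim
   to a product of a geometric series and a two-element set. *)
pose h (k : int) := (`|k|%N, if k is Posz _ then true else false).
apply: (@bsum_le _ _ (fun k => rho ^+ (h k).1 * 1)) => [k|]; first by rewrite mulr1.
apply: (@bsum_inj _ _ h (fun p => rho ^+ p.1 * 1)).
  by case=> [m|m] [n|n] //= [->].
apply: (@bsum_prod _ _ (fun n => rho ^+ n) (fun=> 1)) => // [i||].
- exact: exprn_ge0.
- exact: bsum_geom.
exists 2%:R => A.
rewrite (le_trans (@ler_sum_fset _ (fun=> 1) A [fset true; false]%fset _ _)) //.
  by apply/fsubsetP => -[] _; rewrite !inE.
by rewrite big_fsetU1 ?inE //= big_seq_fset1.
Qed.

Lemma bsum_geom_tuple (rho : R) n : 0 <= rho < 1 ->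
  bsum (fun k : n.-tuple int => \prod_(x <- k) rho ^+ `|x|%N).
Proof.
move=> r01; have r0 : 0 <= rho by case/andP: r01.
elim: n => [|n IHn].
  exists 1 => A; apply: (@le_trans _ _ (\sum_(k <- [fset [tuple] : 0.-tuple int]%fset) 1)).
    apply: (@le_trans _ _ (\sum_(k <- A) 1)).
      by apply: ler_sum => k _; rewrite tuple0 big_nil.
    apply: ler_sum_fset => //; apply/fsubsetP => k _.
    by rewrite tuple0 inE.
  by rewrite big_seq_fset1.
pose h (k : n.+1.-tuple int) := (thead k, [tuple of behead k] : n.-tuple int).
have prod_ge0 m (k : m.-tuple int) : 0 <= \prod_(x <- k) rho ^+ `|x|%N.
  by apply: prodr_ge0 => x _; exact: exprn_ge0.
apply: (@bsum_le _ _ (fun k => rho ^+ `|(h k).1|%N * \prod_(x <- (h k).2) rho ^+ `|x|%N)).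
  by move=> k; rewrite [in leLHS](tuple_eta k) /= big_cons.
apply: (@bsum_inj _ _ h (fun p => rho ^+ `|p.1|%N * \prod_(x <- p.2) rho ^+ `|x|%N)).
  move=> k k' [e1 e2]; rewrite (tuple_eta k) (tuple_eta k') e1.
  by apply: val_inj => /=; rewrite e2.
apply: (@bsum_prod _ _ (fun x : int => rho ^+ `|x|%N)
  (fun k : n.-tuple int => \prod_(x <- k) rho ^+ `|x|%N)) => // [i|].
  exact: exprn_ge0.
exact: bsum_geom_int.
Qed.

End Summation.

Arguments hsumZ {R T f} c {s} _.

(** * Limits in [R[i]]: existence from geometrically small steps, and uniqueness *)

Section Completeness.
Variable R : realType.

Lemma nm_geRe (x : R[i]) : `|complex.Re x| <= nm x.
Proof. by rewrite -lecR -nmE normc_ge_Re. Qed.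

Lemma nm_geIm (x : R[i]) : `|complex.Im x| <= nm x.
Proof.
have -> : complex.Im x = - complex.Re (x * 'i) by case: x => a b /=; ring.
rewrite normrN (le_trans (nm_geRe _)) // nmM.
have -> : nm ('i : R[i]) = 1 by rewrite /= expr0n expr1n add0r sqrtr1.
by rewrite mulr1.
Qed.

Lemma nm_leReIm (x : R[i]) : nm x <= `|complex.Re x| + `|complex.Im x|.
Proof.
case: x => a b /=; rewrite -(@ler_pXn2r _ 2) ?nnegrE ?sqrtr_ge0 ?addr_ge0 //.
rewrite sqr_sqrtr ?addr_ge0 ?sqr_ge0 //.
rewrite sqrrD !real_normK ?num_real //.
have := mulr_ge0 (normr_ge0 a) (normr_ge0 b); rewrite mulr2n; lra.
Qed.

Lemma cvg_geometric_steps_real (a : nat -> R) (c rho : R) :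
  0 <= rho < 1 -> (forall n, `|a n.+1 - a n| <= c * rho ^+ n) ->
  exists l : R, a @ \oo --> l.
Proof.
move=> /andP[r0 r1] ac; pose d n := a n.+1 - a n.
have cd : cvgn (series d).
  have cg : cvgn (series (geometric c rho)).
    by apply: is_cvg_geometric_series; rewrite ger0_norm.
  apply: normed_cvg; apply: (series_le_cvg _ _ _ cg) => n //=.
    by rewrite (le_trans _ (ac n)).
  exact: ac.
exists (a 0%N + limn (series d)).
have : (fun n => a 0%N + series d n) @ \oo --> a 0%N + limn (series d).
  exact: cvgD (cvg_cst _) cd.
rewrite (_ : (fun n => _) = a) //.
apply/funext => n; rewrite /series /= /d telescope_sumr //; ring.
Qed.

Lemma cvg_geometric_steps (u : nat -> R[i]) (c rho : R) :
  0 <= rho < 1 -> (forall n, nm (u n.+1 - u n) <= c * rho ^+ n) ->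
  exists l : R[i], (u : nat -> R[i]^o) @ \oo --> (l : R[i]^o).
Proof.
move=> r01 uc.
have [|a ha] := @cvg_geometric_steps_real (fun n => complex.Re (u n)) c rho r01.
  by move=> n; rewrite -raddfB (le_trans (nm_geRe _)).
have [|b hb] := @cvg_geometric_steps_real (fun n => complex.Im (u n)) c rho r01.
  by move=> n; rewrite -raddfB (le_trans (nm_geIm _)).
exists (a +i* b); apply/nm_cvgP => e e0; have e20 : 0 < e / 2 by rewrite divr_gt0.
move/cvgrPdist_le/(_ _ e20): ha => ha; move/cvgrPdist_le/(_ _ e20): hb => hb.
near=> n.
rewrite (le_trans (nm_leReIm _)) // !raddfB /= [e]splitr lerD //.
  by near: n.
by near: n.
Unshelve. all: end_near.
Qed.

Lemma cvgC_unique (u : nat -> R[i]) (l l' : R[i]) :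
  (u : nat -> R[i]^o) @ \oo --> (l : R[i]^o) ->
  (u : nat -> R[i]^o) @ \oo --> (l' : R[i]^o) -> l = l'.
Proof. by move=> ul ul'; exact: (cvg_unique (@norm_hausdorff _ R[i]^o) ul ul'). Qed.

Lemma cvgC_eqr (u : nat -> R[i]) (l l' : R[i]) :
  (u : nat -> R[i]^o) @ \oo --> (l : R[i]^o) -> l = l' ->
  (u : nat -> R[i]^o) @ \oo --> (l' : R[i]^o).
Proof. by move=> + <-. Qed.

Lemma cvgC_mul (u v : nat -> R[i]) (l m : R[i]) :
  (u : nat -> R[i]^o) @ \oo --> (l : R[i]^o) ->
  (v : nat -> R[i]^o) @ \oo --> (m : R[i]^o) ->
  (fun n => u n * v n : R[i]^o) @ \oo --> (l * m : R[i]^o).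
Proof. exact: cvgM. Qed.

Lemma cvgC_mull (c : R[i]) (u : nat -> R[i]) (l : R[i]) :
  (u : nat -> R[i]^o) @ \oo --> (l : R[i]^o) ->
  (fun n => c * u n : R[i]^o) @ \oo --> (c * l : R[i]^o).
Proof. exact: cvgM (@cvg_cst R[i]^o _ _ _ _). Qed.

End Completeness.

Arguments cvgC_mull {R} c {u l} _.

(** * Infinite q-products *)

Lemma cvg_double : (fun n => n.*2) @ \oo --> \oo.
Proof.
move=> A [N _ NP]; exists N => // n /= Nn; apply: NP => /=.
by rewrite (leq_trans Nn) // -addnn leq_addr.
Qed.

Section InfiniteProducts.
Variable R : realType.
Implicit Types (x y q : R[i]).

Lemma qpoch0 x q : qpoch x q 0%N = 1.
Proof. by rewrite /qpoch big_geq. Qed.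

Lemma qpochS x q (n : nat) : qpoch x q n.+1 = qpoch x q n * (1 - x * q ^+ n).
Proof. by rewrite /qpoch big_nat_recr. Qed.

Lemma qpochSl x q (n : nat) : qpoch x q n.+1 = (1 - x) * qpoch (x * q) q n.
Proof.
elim: n => [|n IHn]; first by rewrite qpochS !qpoch0 expr0 mul1r !mulr1.
by rewrite qpochS IHn qpochS exprS; ring.
Qed.

Lemma qpochD x q (m n : nat) :
  qpoch x q (m + n)%N = qpoch x q m * qpoch (x * q ^+ m) q n.
Proof.
elim: n => [|n IHn]; first by rewrite addn0 qpoch0 mulr1.
by rewrite addnS !qpochS IHn exprD; ring.
Qed.

Lemma qpoch_double x q (n : nat) :
  qpoch x q n.*2 = qpoch x (q ^+ 2) n * qpoch (x * q) (q ^+ 2) n.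
Proof.
elim: n => [|n IHn]; first by rewrite !qpoch0 mulr1.
by rewrite doubleS !qpochS IHn -!exprM mul2n (exprS q n.*2); ring.
Qed.

(* |P_n - 1| <= 2 S_n for the partial products, as long as S_n <= 1/2 *)
Lemma qpoch_near1 x q : nm q < 1 -> nm x <= (1 - nm q) / 2 ->
  forall n : nat, nm (qpoch x q n - 1) <= 2 * nm x / (1 - nm q).
Proof.
move=> q1 xq n; have q0 := nm_ge0 q; have d0 : 0 < 1 - nm q by lra.
pose s n := nm x * (1 - nm q ^+ n) / (1 - nm q).
suff H : nm (qpoch x q n - 1) <= 2 * s n.
  apply: (le_trans H); rewrite /s mulrA ler_pM2r ?invr_gt0 // mulrA.
  rewrite -[leRHS]mulr1 ler_wpM2l ?mulr_ge0 ?nm_ge0 //.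
  by rewrite gerBl exprn_ge0.
have s_le m : s m <= 1 / 2.
  rewrite /s ler_pdivrMr // (le_trans (y := nm x)) //; last by lra.
  by rewrite ler_piMr ?nm_ge0 // gerBl exprn_ge0.
elim: n => [|n IHn].
  by rewrite qpoch0 subrr nm0 /s expr0 subrr mulr0 mul0r mulr0.
have Pn : nm (qpoch x q n) <= 2.
  have := nmD (qpoch x q n - 1) 1; rewrite subrK nm1; have := s_le n; lra.
have sS : s n.+1 = s n + nm x * nm q ^+ n.
  by rewrite /s exprS; field; rewrite gt_eqF.
rewrite qpochS.
have -> : qpoch x q n * (1 - x * q ^+ n) - 1 =
    (qpoch x q n - 1) - qpoch x q n * (x * q ^+ n) by ring.
apply: (le_trans (nmB _ _)); rewrite sS mulrDr lerD //.
by rewrite !nmM nmX ler_wpM2r // mulr_ge0 ?nm_ge0 ?exprn_ge0.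
Qed.

Lemma nm_cvg0 x q : nm q < 1 ->
  (fun n => x * q ^+ n : R[i]^o) @ \oo --> (0 : R[i]^o).
Proof.
move=> q1; apply/nm_cvgP => e e0.
have : (fun n => nm x * nm q ^+ n) @ \oo --> (0 : R).
  by apply: cvg_geometric; rewrite ger0_norm // nm_ge0.
move=> /cvgrPdist_le/(_ _ e0); apply: filterS => n.
by rewrite !sub0r nmN normrN nmM nmX ger0_norm // mulr_ge0 ?exprn_ge0 ?nm_ge0.
Qed.

Lemma shift_small x q (e : R) : nm q < 1 -> 0 < e ->
  exists N, forall n, (N <= n)%N -> nm (x * q ^+ n) <= e.
Proof.
move=> q1 e0; have /nm_cvgP/(_ _ e0)[N _ NP] := nm_cvg0 x q1.
by exists N => n /NP /=; rewrite sub0r nmN.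
Qed.

(** Once finitely many factors are split off, the argument [y] is so small that all partial products
    have modulus at most 2; consecutive ones then differ by at most 2 |y| |q|^n. *)
Lemma qpoch_cvg x q : nm q < 1 ->
  (fun n : nat => qpoch x q n : R[i]^o) @ \oo --> (qpoch_infty x q : R[i]^o).
Proof.
move=> q1; suff [l xl] : exists l : R[i],
    (fun n : nat => qpoch x q n : R[i]^o) @ \oo --> (l : R[i]^o).
  rewrite /qpoch_infty; have -> // : lim ((fun n : nat => qpoch x q n : R[i]^o) @ \oo)
    = (l : R[i]^o) by apply/cvg_lim.
have q0 := nm_ge0 q; have d0 : 0 < (1 - nm q) / 2 by rewrite divr_gt0 // subr_gt0.
have [N NP] := shift_small x q1 d0.
have small := NP N (leqnn N).
have [y yE] : exists y, x * q ^+ N = y by exists (x * q ^+ N).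
rewrite yE in small.
have [||l yl] := @cvg_geometric_steps _ (fun n : nat => qpoch y q n) (2 * nm y) (nm q).
- by rewrite q0.
- move=> n; rewrite qpochS mulrBr mulr1 addrC addKr nmN !nmM nmX mulrA.
  rewrite ler_wpM2r ?exprn_ge0 // ler_wpM2r ?nm_ge0 //.
  have := qpoch_near1 q1 small n; have := nmD (qpoch y q n - 1) 1.
  rewrite subrK nm1.
  have : 2 * nm y / (1 - nm q) <= 1 by rewrite ler_pdivrMr; lra.
  lra.
exists (qpoch x q N * l).
rewrite -(cvg_shiftn N); under eq_fun do rewrite addnC qpochD yE.
exact: cvgM (@cvg_cst R[i]^o _ _ _ _) yl.
Qed.

Arguments qpoch_cvg x [q] _.

Lemma qpoch_inftyE x q l : nm q < 1 ->
  (fun n : nat => qpoch x q n : R[i]^o) @ \oo --> (l : R[i]^o) -> qpoch_infty x q = l.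
Proof. by move=> q1; apply: cvg_unique => //; exact: qpoch_cvg. Qed.

Lemma qpoch_infty_shift x q (n : nat) : nm q < 1 ->
  qpoch_infty x q = qpoch x q n * qpoch_infty (x * q ^+ n) q.
Proof.
move=> q1; apply: qpoch_inftyE => //.
rewrite -(cvg_shiftn n); under eq_fun do rewrite addnC qpochD.
exact: cvgM (@cvg_cst R[i]^o _ _ _ _) (qpoch_cvg (x * q ^+ n) q1).
Qed.

Lemma qpoch_inftyS x q : nm q < 1 ->
  qpoch_infty x q = (1 - x) * qpoch_infty (x * q) q.
Proof.
move=> q1; rewrite (qpoch_infty_shift x 1 q1) qpochS qpoch0.
by rewrite !expr0 expr1 mulr1 mul1r.
Qed.

Lemma qpoch_infty_near1 x q : nm q < 1 -> nm x <= (1 - nm q) / 2 ->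
  nm (qpoch_infty x q - 1) <= 2 * nm x / (1 - nm q).
Proof.
move=> q1 xq; apply/ler_addgt0Pr => e e0.
have /nm_cvgP/(_ _ e0)[N _ /(_ N (leqnn N)) /= NP] := qpoch_cvg x q1.
have := qpoch_near1 q1 xq N.
have := nmD (qpoch_infty x q - qpoch x q N) (qpoch x q N - 1).
rewrite addrA subrK; lra.
Qed.

Lemma qpoch_infty_cvg1 x q : nm q < 1 ->
  (fun n => qpoch_infty (x * q ^+ n) q : R[i]^o) @ \oo --> (1 : R[i]^o).
Proof.
move=> q1; apply/nm_cvgP => e e0; have d0 : 0 < 1 - nm q by lra.
have [|N NP] := @shift_small x q (Num.min ((1 - nm q) / 2) (e * (1 - nm q) / 2)) q1.
  by rewrite lt_min !divr_gt0 ?mulr_gt0.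
exists N => // n /NP; rewrite le_min => /andP[h1 h2] /=.
rewrite nmBC (le_trans (qpoch_infty_near1 q1 h1)) // ler_pdivrMr //; lra.
Qed.

Lemma qpoch_infty0 q : nm q < 1 -> qpoch_infty 0 q = 1.
Proof.
move=> q1; apply: qpoch_inftyE => //.
have -> : (fun n : nat => qpoch 0 q n) = fun=> 1.
  apply/funext; elim=> [|n IHn]; first by rewrite qpoch0.
  by rewrite qpochS IHn mul0r subr0 mulr1.
exact: cvg_cst.
Qed.

Lemma qpoch_infty_neq0 x q : nm q < 1 -> (forall n, 1 - x * q ^+ n != 0) ->
  qpoch_infty x q != 0.
Proof.
move=> q1 x1; have q0 := nm_ge0 q.
(* With a third in place of the half of [qpoch_infty_near1], the tail product stays within 2/3 of 1,
   hence is nonzero. *)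
have d0 : 0 < (1 - nm q) / 3 by rewrite divr_gt0 // subr_gt0.
have [N NP] := shift_small x q1 d0; have small := NP N (leqnn N).
rewrite (qpoch_infty_shift x N q1) mulf_neq0 //.
  elim: N {NP small} => [|N IHN]; first by rewrite qpoch0 oner_eq0.
  by rewrite qpochS mulf_neq0.
apply/negP => /eqP y0; have := @qpoch_infty_near1 (x * q ^+ N) q q1.
rewrite y0 sub0r nmN nm1; set t := nm _ in small *.
have : 2 * t / (1 - nm q) < 1 by rewrite ltr_pdivrMr; lra.
have : t <= (1 - nm q) / 2 by lra.
by move=> h1 h2 /(_ h1); lra.
Qed.

Lemma nm_sqr_lt1 q : nm q < 1 -> nm (q ^+ 2) < 1.
Proof. by move=> q1; rewrite nmX exprn_ilt1 ?nm_ge0. Qed.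

Lemma qpoch_infty_double x q : nm q < 1 ->
  qpoch_infty x q = qpoch_infty x (q ^+ 2) * qpoch_infty (x * q) (q ^+ 2).
Proof.
move=> q1; have q2 := nm_sqr_lt1 q1.
have sub := cvg_comp _ _ cvg_double (qpoch_cvg x q1).
apply: (cvgC_unique sub).
rewrite (_ : _ \o _ = (fun n : nat => qpoch x (q ^+ 2) n * qpoch (x * q) (q ^+ 2) n)).
  exact: cvgM (qpoch_cvg x q2) (qpoch_cvg (x * q) q2).
by apply/funext => n; rewrite -qpoch_double.
Qed.

(** Each factor is at most 1 + B |q|^j in modulus, so the convergent product with argument [- B] and
    base |q| is a majorant that does not depend on [y]. *)
Lemma qpoch_nm_bound q (B : R) : nm q < 1 -> exists c : R, 0 < c /\
  forall (y : R[i]) (m : nat), nm y <= B -> nm (qpoch y q m) <= c.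
Proof.
move=> q1; have q1' : nm ((nm q)%:C) < 1.
  by rewrite /= expr0n addr0 sqrtr_sqr ger0_norm ?nm_ge0.
have [c [c0 cP]] := cvg_bounded (qpoch_cvg (- B%:C) q1').
exists c; split=> // y m yB; apply: le_trans (cP m).
have B0 : 0 <= B := le_trans (nm_ge0 y) yB.
have -> : nm (qpoch (- B%:C) (nm q)%:C m) = \prod_(1 <= j < m.+1) (1 + B * nm q ^+ j.-1).
  rewrite /qpoch -(@rmorph1 _ _ (real_complex R)).
  under eq_bigr do rewrite mulNr opprK -rmorphXn -rmorphM -rmorphD.
  rewrite -rmorph_prod /= expr0n addr0 sqrtr_sqr ger0_norm //.
  by apply: prodr_ge0 => j _; rewrite addr_ge0 ?mulr_ge0 ?exprn_ge0 ?nm_ge0.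
elim: m => [|m IHm]; first by rewrite qpoch0 big_geq // nm1.
rewrite qpochS nmM big_nat_recr //= ler_pM ?nm_ge0 //.
by rewrite (le_trans (nmB _ _)) // nm1 lerD2l nmM nmX ler_wpM2r ?exprn_ge0 ?nm_ge0.
Qed.

End InfiniteProducts.

Arguments qpoch_cvg {R} x [q] _.

(** * q-series *)

#[local] Arguments qpoch {R} x q k : simpl never.

(* 1 / (q; q)_k for every integer k; it vanishes for k < 0 (rqpoch_neg). *)
Definition rqpoch (R : realType) (q : R[i]) (k : int) : R[i] :=
  qpoch_infty (q ^ (k + 1)) q / qpoch_infty q q.

Definition gaussw (R : realType) (q z : R[i]) (k : int) : R[i] :=
  q ^ (k ^+ 2) * z ^ k.

Section QSeries.
Variables (R : realType) (q : R[i]).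
Hypotheses (q0 : q != 0) (q1 : nm q < 1).

Local Notation F y := (qpoch_infty y q).
Local Notation G y := (qpoch_infty y (q ^+ 2)).
Local Notation r := (rqpoch q).

Let nq0 : 0 <= nm q := nm_ge0 q.
Let nq01 : 0 <= nm q < 1. Proof. by rewrite nq0. Qed.
Let q2_lt1 : nm (q ^+ 2) < 1. Proof. exact: nm_sqr_lt1. Qed.

Lemma one_subX_neq0 n : 1 - q ^+ n.+1 != 0.
Proof.
apply/negP => /eqP /subr0_eq e; have := congr1 (fun y => nm y) e.
rewrite nm1 nmX => e'; have : nm q ^+ n.+1 < 1 by rewrite exprn_ilt1.
by rewrite -e' ltxx.
Qed.

Lemma qpoch_infty_qq_neq0 : F q != 0.
Proof. by apply: qpoch_infty_neq0 => // n; rewrite -exprS one_subX_neq0. Qed.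

Lemma qpoch_infty_qq2_neq0 : G q != 0.
Proof.
by apply: qpoch_infty_neq0 => // n; rewrite -exprM -exprS one_subX_neq0.
Qed.

Lemma rqpoch_pred k : r (k - 1) = (1 - q ^ k) * r k.
Proof.
by rewrite /rqpoch subrK mulrA (qpoch_inftyS (q ^ k) q1) expfzDr // expr1z.
Qed.

Lemma rqpoch0 : r 0 = 1.
Proof. by rewrite /rqpoch add0r expr1z divff // qpoch_infty_qq_neq0. Qed.

(** The factor 1 - q^0 annihilates the value at -1, and [rqpoch_pred] carries the zero downwards. *)
Lemma rqpoch_neg k : k < 0 -> r k = 0.
Proof.
case: k => // n _; elim: n => [|n IHn].
  by rewrite (_ : Negz 0 = 0 - 1) // rqpoch_pred expr0z subrr mul0r.
by rewrite (_ : Negz n.+1 = Negz n - 1) ?rqpoch_pred ?IHn ?mulr0 //; lia.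
Qed.

Lemma rqpoch_sub_nat (m n : nat) : (n < m)%N -> r (n%:Z - m%:Z) = 0.
Proof. by move=> nm; rewrite rqpoch_neg //; lia. Qed.

Lemma rqpoch_natS (n : nat) : r n = (1 - q ^+ n.+1) * r n.+1.
Proof. by rewrite (_ : Posz n = n.+1%:Z - 1) ?rqpoch_pred //; lia. Qed.

(** For [k < 0] this includes the poles: if some 1 - x q^(-j) with 1 <= j <= -k vanishes, the left
    side is 0 by the convention on inverses, and the right side is 0 because [F (x * q ^ k)]
    contains that factor. *)
Lemma qpoch_inv x (k : int) : F x != 0 -> (qpoch x q k)^-1 = F (x * q ^ k) / F x.
Proof.
move=> x0; case: k => n.
  have := x0; rewrite [F x](qpoch_infty_shift x n q1) mulf_eq0 negb_or.
  by move=> /andP[h1 h2]; rewrite -exprnP; field; rewrite h1 h2.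
rewrite -(mulfK x0 (_^-1)); congr (_ / _).
rewrite /qpoch; elim: n => [|n IHn].
  rewrite big_nat1 invrK.
  by rewrite (qpoch_inftyS (x * q ^ Negz 0) q1) NegzE -exprnN expr1 mulfVK.
rewrite big_nat_recr //= invfM invrK mulrAC IHn mulrC.
rewrite (qpoch_inftyS (x * q ^ Negz n.+1) q1) !NegzE -!exprnN; congr (_ * F _).
by rewrite [q ^+ n.+2]exprS; field; rewrite q0 expf_neq0.
Qed.

Lemma rqpochE (k : int) : r k = (qpoch q q k)^-1.
Proof.
by rewrite qpoch_inv ?qpoch_infty_qq_neq0 // /rqpoch addrC expfzDr // expr1z.
Qed.

Lemma rqpoch_cvg (j : int) :
  (fun n : nat => r (n%:Z + j) : R[i]^o) @ \oo --> ((F q)^-1 : R[i]^o).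
Proof.
rewrite -[(F q)^-1]mul1r.
rewrite (_ : (fun n : nat => _) = fun n => F (q ^ (j + 1) * q ^+ n) * (F q)^-1).
  exact: cvgM (qpoch_infty_cvg1 _ q1) (@cvg_cst R[i]^o _ _ _ _).
apply/funext => n; rewrite /rqpoch; congr (F _ / _).
by rewrite exprnP -expfzDr //; congr (_ ^ _); lia.
Qed.

Lemma rqpoch_bounded : exists c : R, 0 < c /\ forall k, nm (r k) <= c.
Proof.
have := rqpoch_cvg 0; move=> /cvg_bounded[c [c0 cP]]; exists c; split => // -[n|n].
  by have := cP n; rewrite addr0.
by rewrite rqpoch_neg // nm0 ltW.
Qed.

Lemma gaussw_bounded z : z != 0 ->
  exists c : R, 0 < c /\ forall k : int, nm (gaussw q z k) <= c * nm q ^+ `|k|%N.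
Proof.
move=> z0; have nz0 : 0 < nm z by rewrite nm_gt0.
(* [Z] dominates 1, |z| and 1/|z|, so that |z|^k is at most Z^|k| for either sign of [k]. *)
pose Z := nm z + (nm z)^-1 + 1.
have Z1 : 1 <= Z by rewrite /Z lerDr addr_ge0 ?invr_ge0 ?ltW.
have Z0 : 0 <= Z by lra.
have zZ (k : int) : nm z ^ k <= Z ^+ `|k|%N.
  have iz0 : 0 <= (nm z)^-1 by rewrite invr_ge0 ltW.
  case: k => n; [rewrite -exprnP | rewrite NegzE -exprnN -exprVn].
    by rewrite lerXn2r ?nnegrE ?(ltW nz0) // /Z; lra.
  by rewrite lerXn2r ?nnegrE // /Z; lra.
have [N NP] : exists N, forall n, (N <= n)%N -> Z * nm q ^+ n <= 1.
  have : (fun n => Z * nm q ^+ n) @ \oo --> (0 : R).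
    by apply: cvg_geometric; rewrite ger0_norm.
  move=> /cvgrPdist_le/(_ _ ltr01)[N _ NP]; exists N => n /NP /=.
  by rewrite sub0r normrN ger0_norm // mulr_ge0 ?exprn_ge0.
exists (Z ^+ N); split=> [|k]; first by rewrite exprn_gt0 //; lra.
rewrite /gaussw nmM !nmXz.
have -> : (nm q ^ (k ^+ 2) = nm q ^+ (`|k| * `|k|)%N).
  by rewrite [RHS]exprnP PoszM abszE -expr2 real_normK ?num_real.
case: (`|k|%N) (zZ k) => [|n] zk.
  by rewrite expr0 mul1r mulr1 (le_trans zk) // expr0 exprn_ege1.
(* With |k| = n + 1, one factor |q|^(n+1) is kept for the bound; what remains is at most (Z
   |q|^n)^(n+1), hence at most 1 for [n >= N] and at most Z^N for [n < N]. *)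
rewrite mulSn exprD -mulrA mulrC ler_wpM2r ?exprn_ge0 //.
apply: (le_trans (ler_wpM2l (exprn_ge0 _ nq0) zk)).
rewrite exprM mulrC -exprMn.
have [nN|Nn] := ltnP n N.
  apply: (@le_trans _ _ (Z ^+ n.+1)); last exact: ler_weXn2l.
  rewrite lerXn2r ?nnegrE ?mulr_ge0 ?exprn_ge0 //.
  by rewrite ler_piMr // exprn_ile1 // ltW.
apply: (@le_trans _ _ 1); last exact: exprn_ege1.
by apply: exprn_ile1; [rewrite mulr_ge0 ?exprn_ge0 | exact: NP].
Qed.

(** q-Pascal rule for binomials divided by (q; q)_N. It comes from 1 - q^(N+1) = (1 - q^(N+1-m)) +
    q^(N+1-m) (1 - q^m). *)
Lemma rqpoch_pascal (m N : nat) : (m <= N.+1)%N ->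
  (1 - q ^+ N.+1) * (r m * r (N.+1%:Z - m%:Z)) =
  r m * r (N%:Z - m%:Z) + q ^+ (N.+1 - m) * (r (m%:Z - 1) * r (N.+1%:Z - m%:Z)).
Proof.
move=> mN; rewrite rqpoch_pred.
rewrite (_ : N%:Z - m%:Z = (N.+1%:Z - m%:Z) - 1) ?rqpoch_pred; last by lia.
rewrite -exprnP (_ : N.+1%:Z - m%:Z = (N.+1 - m)%N); last by lia.
rewrite -exprnP -[in q ^+ N.+1](subnK mN) exprD; ring.
Qed.

(* Multiplied by (q; q)_N / F (a q^(N+1)) this is the usual
   sum_m q^(m^2) a^m [N choose m] (a q^(m+1); q)_(N-m) = 1; induction on N by Pascal's rule. *)
Lemma q_vandermonde (N : nat) (a : R[i]) :
  \sum_(0 <= m < N.+1) q ^+ (m ^ 2) * a ^+ m * r m * r (N%:Z - m%:Z)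
     * F (a * q ^+ m.+1) = r N * F (a * q ^+ N.+1).
Proof.
elim: N a => [|N IHN] a.
  by rewrite big_nat1 !subr0 !rqpoch0 !expr0 !mul1r.
apply: (mulfI (one_subX_neq0 N)); rewrite mulr_sumr.
transitivity (\sum_(0 <= m < N.+2)
   (q ^+ (m ^ 2) * a ^+ m * r m * r (N%:Z - m%:Z) * F (a * q ^+ m.+1)
   + q ^+ (m ^ 2) * a ^+ m * q ^+ (N.+1 - m) * r (m%:Z - 1) * r (N.+1%:Z - m%:Z)
     * F (a * q ^+ m.+1))).
  rewrite !big_nat; apply: eq_bigr => m mN.
  have /rqpoch_pascal p : (m <= N.+1)%N by lia.
  rewrite (_ : _ * (_ * _ * r m * _ * _) = q ^+ (m ^ 2) * a ^+ m * F (a * q ^+ m.+1)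
    * ((1 - q ^+ N.+1) * (r m * r (N.+1%:Z - m%:Z)))); last by ring.
  by rewrite p; ring.
rewrite big_split /= [X in X + _]big_nat_recr //= [X in _ + X]big_nat_recl //=.
rewrite [r (N%:Z - N.+1%:Z)]rqpoch_neg; last by lia.
rewrite [r (0 - 1)]rqpoch_neg // !(mulr0, mul0r) addr0 add0r IHN.
(* The second sum, shifted by one, is the induction hypothesis at [a * q]; the two parts recombine
   through F (a q^(N+1)) = (1 - a q^(N+1)) F (a q^(N+2)). *)
transitivity (r N * F (a * q ^+ N.+1) + a * q ^+ N.+1 * (r N * F (a * q * q ^+ N.+1))).
  congr (_ + _); rewrite -IHN mulr_sumr !big_nat; apply: eq_bigr => m mN.
  rewrite (_ : m.+1%:Z - 1 = m); last by lia.
  rewrite (_ : N.+1%:Z - m.+1%:Z = N%:Z - m%:Z); last by lia.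
  rewrite (_ : a * q * q ^+ m.+1 = a * q ^+ m.+2); last by rewrite !exprS; ring.
  rewrite (_ : q ^+ (m.+1 ^ 2) * a ^+ m.+1 * q ^+ (N.+1 - m.+1) =
     a * q ^+ N.+1 * (q ^+ (m ^ 2) * (a * q) ^+ m)); first by ring.
  rewrite exprMn exprS mulrAC -exprD.
  rewrite (_ : (m.+1 ^ 2 + (N.+1 - m.+1) = N.+1 + m ^ 2 + m)%N) ?exprD; first by ring.
  by rewrite subSS -!mulnn; lia.
rewrite (qpoch_inftyS (a * q ^+ N.+1) q1) rqpoch_natS -!mulrA -[q * _]exprS -exprSr; ring.
Qed.

(** The limit of [q_vandermonde] as [N] grows. Multiplication by [F q] compensates the limit 1 / (q;
    q)_oo of [r N] and of [r (N - m)]. *)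
Lemma q_vandermonde_infty (a : R[i]) : a != 0 ->
  hsum (fun m : nat => q ^+ (m ^ 2) * a ^+ m * r m * F (a * q ^+ m.+1)) 1.
Proof.
move=> a0; have [c1 [c10 c1P]] := gaussw_bounded a0.
have [c2 [c20 c2P]] := rqpoch_bounded.
have [c3 [c30 c3P]] := cvg_bounded (qpoch_infty_cvg1 (a * q) q1).
pose f N (m : nat) := q ^+ (m ^ 2) * a ^+ m * r m * r (N%:Z - m%:Z) * F (a * q ^+ m.+1).
have Fq0 := qpoch_infty_qq_neq0.
have fs N : hsum (fun m => F q * f N m) (F q * (r N * F (a * q ^+ N.+1))).
  apply: hsumZ; rewrite -q_vandermonde; apply: hsum_nat => m Nm.
  by rewrite /f rqpoch_sub_nat // mulr0 mul0r.
apply: (tannery (g := fun m => nm (F q) * (c1 * c2 * c2 * c3) * nm q ^+ m) _ _ fs).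
- apply: bsumZ; last exact: bsum_geom.
  by rewrite mulr_ge0 ?nm_ge0 // !mulr_ge0 // ltW.
- move=> N m; rewrite -mulrA; apply: nm_leM => //.
  rewrite (_ : c1 * c2 * c2 * c3 * nm q ^+ m = c1 * nm q ^+ m * c2 * c2 * c3); last by ring.
  apply: nm_leM; last by rewrite exprS mulrA; exact: c3P.
  do 2![apply: nm_leM => //].
  by have := c1P m; rewrite /gaussw -exprnP.
- move=> m; rewrite (_ : q ^+ _ * _ * _ * _ =
      F q * (q ^+ (m ^ 2) * a ^+ m * r m * (F q)^-1 * F (a * q ^+ m.+1))); last by field.
  rewrite /f; apply: cvgM; first exact: cvg_cst.
  apply: cvgM; last exact: cvg_cst.
  apply: cvgM; first exact: cvg_cst.
  exact: (rqpoch_cvg (- m%:Z)).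
- rewrite (_ : 1 = F q * ((F q)^-1 * 1)); last by rewrite mulr1 divff.
  apply: cvgM; first exact: cvg_cst.
  apply: cvgM; first by have := rqpoch_cvg 0; under eq_fun do rewrite addr0.
  by under eq_fun do rewrite exprS mulrA; exact: qpoch_infty_cvg1.
Qed.

(** * Lebesgue's identity *)

Definition lebesgue_term x (m : nat) := q ^+ 'C(m.+1, 2) * r m * qpoch x q m.

(** The expected value [G (x * q)], up to a constant, satisfies S(x) = (1 - x q) S(x q^2). This is
    the same equation for partial sums, with an explicit remainder that tends to 0. *)
Lemma lebesgue_telescope x (M : nat) :
  \sum_(0 <= m < M.+1)
     (lebesgue_term x m - (1 - x * q) * lebesgue_term (x * q ^+ 2) m) =
  x * q ^+ M.+1 * (q ^+ 'C(M.+1, 2) * r M) * qpoch (x * q) q M.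
Proof.
have shift (m : nat) : (1 - x * q) * qpoch (x * q ^+ 2) q m = qpoch (x * q) q m.+1.
  by rewrite qpochSl expr2 mulrA.
elim: M => [|M IHM].
  by rewrite big_nat1 /lebesgue_term !qpoch0 rqpoch0 bin_small // !expr0 expr1; ring.
rewrite big_nat_recr //= IHM /lebesgue_term.
rewrite (_ : (1 - x * q) * (q ^+ 'C(M.+2, 2) * r M.+1 * qpoch (x * q ^+ 2) q M.+1)
  = q ^+ 'C(M.+2, 2) * r M.+1 * qpoch (x * q) q M.+2); last by rewrite -shift; ring.
rewrite [qpoch x q _]qpochSl.
rewrite [qpoch (x * q) q M.+2]qpochS [qpoch (x * q) q M.+1]qpochS rqpoch_natS.
rewrite [in q ^+ 'C(M.+2, 2)]binS bin1 exprD.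
by rewrite (exprS q M.+1) (exprS q M); ring.
Qed.

Lemma lebesgue_term_bounded (B : R) : exists c : R, 0 < c /\
  forall y m, nm y <= B -> nm (lebesgue_term y m) <= c * nm q ^+ m.
Proof.
have [c1 [c10 c1P]] := rqpoch_bounded; have [c2 [c20 c2P]] := qpoch_nm_bound B q1.
exists (c1 * c2); split=> [|y m yB]; first exact: mulr_gt0.
rewrite (_ : c1 * c2 * nm q ^+ m = nm q ^+ m * c1 * c2); last by ring.
apply: nm_leM; last exact: c2P.
apply: nm_leM => //.
by rewrite nmX binS bin1 exprD ler_piMl ?exprn_ge0 // exprn_ile1 // ltW.
Qed.

Lemma lebesgue_step x :
  hsum (fun m => lebesgue_term x m - (1 - x * q) * lebesgue_term (x * q ^+ 2) m) 0.
Proof.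
set d := fun m => _.
have [c [c0 cP]] := lebesgue_term_bounded (nm x + nm (x * q ^+ 2)).
pose C := c + nm (1 - x * q) * c.
have C0 : 0 <= C by rewrite addr_ge0 ?mulr_ge0 ?nm_ge0 ?ltW.
have dC m : nm (d m) <= C * nm q ^+ m.
  rewrite /d /C [leRHS]mulrDl; apply: (le_trans (nmB _ _)); apply: lerD.
    by rewrite cP // lerDl nm_ge0.
  by rewrite -mulrA; apply: nm_leM => //; rewrite cP // lerDr nm_ge0.
(* Truncation at [M] gives finite sums, and [tannery] upgrades the limit of the ordered partial sums
   to an unconditional sum. *)
apply: (tannery (f := fun M m => if (m < M.+1)%N then d m else 0)
  (g := fun m => C * nm q ^+ m) (s := fun M => \sum_(0 <= m < M.+1) d m)).
- by apply: bsumZ => //; exact: bsum_geom.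
- by move=> M m; case: ifP => // _; rewrite nm0 mulr_ge0 ?exprn_ge0.
- move=> M; rewrite [X in hsum _ X](_ : _ =
      \sum_(0 <= m < M.+1) (if (m < M.+1)%N then d m else 0)).
    by apply: hsum_nat => m; rewrite leqNgt => /negbTE ->.
  by rewrite !big_nat; apply: eq_bigr => m /andP[_ ->].
- move=> m; apply/nm_cvgP => e e0; exists m => // M /= mM.
  by rewrite ltnS mM subrr nm0 ltW.
rewrite (_ : (fun M => _) = fun M : nat =>
  x * q ^+ M.+1 * (q ^+ 'C(M.+1, 2) * r M) * qpoch (x * q) q M); last first.
  by apply/funext => M; exact: lebesgue_telescope.
have [c1 [c10 c1P]] := rqpoch_bounded.
have [c2 [c20 c2P]] := qpoch_nm_bound (nm (x * q)) q1.
apply/nm_cvgP => e e0.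
have c120 : 0 < c1 * c2 by exact: mulr_gt0.
have [N NP] := shift_small x q1 (divr_gt0 e0 c120).
exists N => // M /= NM; rewrite sub0r nmN.
rewrite -[leRHS](divfK (lt0r_neq0 c120)) -[X in nm X]mulrA.
apply: nm_leM; first by apply: NP; exact: leqW.
apply: nm_leM; last exact: c2P.
rewrite -[leRHS]mul1r; apply: nm_leM => //.
by rewrite nmX exprn_ile1 // ltW.
Qed.

(* Iterating lebesgue_step expresses the sum at x through the sum at 0; the latter
   is obtained from x = 1, where only one term survives. *)
Lemma lebesgue x : hsum (lebesgue_term x) (G (x * q) / G q).
Proof.
have diff y (n : nat) : hsum (fun m => lebesgue_term y m -
    qpoch (y * q) (q ^+ 2) n * lebesgue_term (y * q ^+ n.*2) m) 0.
  elim: n => [|n IHn].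
    have := hsumZ 0 (lebesgue_step y); rewrite mulr0; apply: hsum_ext => m.
    by rewrite qpoch0 expr0 mulr1 mul1r mul0r subrr.
  rewrite -[0]addr0 -[X in 0 + X](mulr0 (qpoch (y * q) (q ^+ 2) n)).
  apply: hsum_ext (hsumD IHn (hsumZ _ (lebesgue_step (y * q ^+ n.*2)))) => m.
  rewrite qpochS doubleS -exprM mul2n.
  rewrite (_ : y * q ^+ n.*2.+2 = y * q ^+ n.*2 * q ^+ 2); last first.
    by rewrite -addn2 exprD mulrA.
  by ring.
have lim0 y : hsum (fun m => lebesgue_term y m - G (y * q) * lebesgue_term 0 m) 0.
  have [c [c0 cP]] := lebesgue_term_bounded (nm y).
  have [c' [c'0 c'P]] := qpoch_nm_bound (nm (y * q)) q2_lt1.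
  have C0 : 0 <= c + c' * c by rewrite addr_ge0 ?mulr_ge0 // ltW.
  apply: (tannery (g := fun m => (c + c' * c) * nm q ^+ m) (s := fun=> 0) _ _ (diff y)).
  - by apply: bsumZ => //; exact: bsum_geom.
  - move=> n m; rewrite [leRHS]mulrDl; apply: (le_trans (nmB _ _)); apply: lerD; first exact: cP.
    rewrite -mulrA; apply: nm_leM; first exact: c'P.
    by apply: cP; rewrite nmM nmX ler_piMr ?nm_ge0 // exprn_ile1 // ltW.
  - move=> m; apply: cvgB; first exact: cvg_cst.
    apply: cvgM; first exact: qpoch_cvg.
    rewrite /lebesgue_term; apply: cvgM; first exact: cvg_cst.
    have y2 : (fun n => y * q ^+ n.*2 : R[i]^o) @ \oo --> (0 : R[i]^o).
      by under eq_fun do rewrite -mul2n exprM; exact: nm_cvg0.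
    elim: m => [|m IHm].
      by rewrite qpoch0; under eq_fun do rewrite qpoch0; exact: cvg_cst.
    rewrite qpochS; under eq_fun do rewrite qpochS.
    apply: (cvgM IHm); apply: cvgB; first exact: cvg_cst.
    exact: (cvgM y2 (@cvg_cst R[i]^o _ _ _ _)).
  - exact: cvg_cst.
(* [qpoch 1 q m] contains the factor 1 - 1 as soon as [m > 0]. *)
have l1 : hsum (lebesgue_term 1) 1.
  rewrite [X in hsum _ X](_ : 1 = \sum_(0 <= m < 1) lebesgue_term 1 m).
    by apply: hsum_nat => -[//|m] _; rewrite /lebesgue_term qpochSl subrr mul0r mulr0.
  by rewrite big_nat1 /lebesgue_term qpoch0 rqpoch0 bin_small // !mulr1.
have Gq0 := qpoch_infty_qq2_neq0.
(* At [y = 1], [lim0] says that 1 minus [G q] times the sum at 0 vanishes; it is solved for the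
   latter sum. *)
have l0 : hsum (lebesgue_term 0) (G q)^-1.
  rewrite (_ : (G q)^-1 = (G q)^-1 * (1 + (-1) * 0)); last by rewrite mulr0 addr0 mulr1.
  apply: hsum_ext (hsumZ _ (hsumD l1 (hsumZ (-1) (lim0 1)))) => m.
  by rewrite mul1r; field.
rewrite (_ : _ / _ = 0 + G (x * q) * (G q)^-1); last by rewrite add0r.
by apply: hsum_ext (hsumD (lim0 x) (hsumZ (G (x * q)) l0)) => m; ring.
Qed.

End QSeries.

(** * Jacobi triple product *)

Lemma sqrn_bin2 m : (m ^ 2 = 2 * 'C(m, 2) + m)%N.
Proof. by elim: m => // m IHm; rewrite binS bin1 -!mulnn in IHm *; lia. Qed.

Lemma sqrn_bin2S m : (m ^ 2 = 'C(m.+1, 2) + 'C(m, 2))%N.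
Proof. by rewrite sqrn_bin2 binS bin1; lia. Qed.

Lemma sqrz_absz (k : int) : k ^+ 2 = (`|k| ^ 2)%N%:Z.
Proof. by rewrite -mulnn PoszM abszE -expr2 real_normK ?num_real. Qed.

(** For equal signs |k + j| = |k| + |j|, and the claim is (a + b)^2 <= 2 (a^2 + b^2); otherwise |k +
    j| is a difference. Exponents are doubled because they belong to |q|^(1/2) in [pair_bounded]. *)
Lemma absz_gauss_exponent (k j : int) :
  (2 * 'C(`|(k + j)%R|, 2) + `|k| + `|j| <= 2 * (`|k| ^ 2 + `|j| ^ 2))%N.
Proof.
have := sqrn_bin2 `|(k + j)%R|%N; have := (nat_Cauchy `|k| `|j|).1.
have : (`|(k + j)%R| = `|k| + `|j| \/ `|(k + j)%R| + `|j| = `|k| \/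
  `|(k + j)%R| + `|k| = `|j|)%N by lia.
move: ('C(_, 2)) => c; move: (`|(k + j)%R|)%N (`|k|)%N (`|j|)%N => n a b.
by rewrite -!mulnn => -[->|[<-|<-]]; nia.
Qed.

Section QBinomial.
Variables (R : realType) (q : R[i]).
Hypotheses (q0 : q != 0) (q1 : nm q < 1).
Local Notation r := (rqpoch q).

(** Rothe's q-binomial theorem divided by (q; q)_N. The induction uses 1 - q^(N+1) = q^m (1 -
    q^(N+1-m)) + (1 - q^m), whose q^m turns [y] into [y * q]. *)
Lemma q_binomial (N : nat) (y : R[i]) :
  \sum_(0 <= m < N.+1) (-1) ^+ m * q ^+ 'C(m, 2) * y ^+ m * r m * r (N%:Z - m%:Z) =
  r N * qpoch y q N.
Proof.
elim: N y => [|N IHN] y.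
  by rewrite big_nat1 !subr0 !rqpoch0 // bin_small // !expr0 qpoch0 !mul1r.
apply: (mulfI (one_subX_neq0 q1 N)); rewrite mulr_sumr.
transitivity (\sum_(0 <= m < N.+2)
   ((-1) ^+ m * q ^+ 'C(m, 2) * (y * q) ^+ m * r m * r (N%:Z - m%:Z)
   + (-1) ^+ m * q ^+ 'C(m, 2) * y ^+ m * r (m%:Z - 1) * r (N.+1%:Z - m%:Z))).
  rewrite !big_nat; apply: eq_bigr => m mN.
  rewrite rqpoch_pred // (_ : N%:Z - m%:Z = (N.+1%:Z - m%:Z) - 1) ?rqpoch_pred //; last by lia.
  rewrite -exprnP (_ : N.+1%:Z - m%:Z = (N.+1 - m)%N); last by lia.
  have mN' : (m <= N.+1)%N by lia.
  by rewrite -exprnP -[in q ^+ N.+1](subnK mN') exprD exprMn; ring.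
rewrite big_split /= [X in X + _]big_nat_recr //= [X in _ + X]big_nat_recl //=.
rewrite rqpoch_sub_nat // [r (0 - 1)]rqpoch_neg // !(mulr0, mul0r) addr0 add0r IHN.
transitivity (r N * qpoch (y * q) q N - y * (r N * qpoch (y * q) q N)).
  congr (_ + _); rewrite -IHN mulr_sumr -sumrN !big_nat; apply: eq_bigr => m mN.
  rewrite (_ : m.+1%:Z - 1 = m); last by lia.
  rewrite (_ : N.+1%:Z - m.+1%:Z = N%:Z - m%:Z); last by lia.
  by rewrite binS bin1 exprD !exprMn !exprS; ring.
by rewrite rqpoch_natS // qpochSl; ring.
Qed.

End QBinomial.

Section TripleProduct.
Variables (R : realType) (p x : R[i]).
Hypotheses (p0 : p != 0) (p1 : nm p < 1) (x0 : x != 0).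

Local Notation H y := (qpoch_infty y (p ^+ 2)).
Local Notation r := (rqpoch (p ^+ 2)).

Let Q0 : p ^+ 2 != 0. Proof. exact: expf_neq0. Qed.
Let Q1 : nm (p ^+ 2) < 1. Proof. exact: nm_sqr_lt1. Qed.

(** The cross term of (j + m)^2 is absorbed into the parameter, [x] becoming x p^(2j). One-sided
    identities can thereby be started at any integer [j]. *)
Lemma gaussw_shift (j : int) (m : nat) :
  gaussw p x (j + m%:Z) = gaussw p x j * (p ^+ (m ^ 2) * (x * p ^ (2 * j)) ^+ m).
Proof.
rewrite /gaussw (expfzDr _ _ x0) exprMn -exprnP.
rewrite (_ : (j + m%:Z) ^+ 2 = j ^+ 2 + (m ^ 2)%N%:Z + 2 * j * m%:Z); last first.
  by rewrite -mulnn PoszM; ring.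
by rewrite !(expfzDr _ _ p0) -exprnP -exprz_exp -exprnP; ring.
Qed.

(** Each factor is turned over, 1 - x p^(1-2i) = -x p^(1-2i) (1 - p^(2i-1) / x) for 1 <= i <= n; the
    extracted monomials multiply to (-1)^n x^n p^(-n^2). *)
Lemma gaussw_reflect (n : nat) :
  (-1) ^+ n * gaussw p x (- n%:Z) * qpoch (x * p ^ (1 - 2 * n%:Z)) (p ^+ 2) n =
  qpoch (p / x) (p ^+ 2) n.
Proof.
elim: n => [|n IHn].
  by rewrite !qpoch0 /gaussw oppr0 !expr0z expr0 !mulr1.
rewrite [RHS]qpochS -IHn qpochSl.
rewrite (_ : x * p ^ (1 - 2 * n.+1%:Z) * p ^+ 2 = x * p ^ (1 - 2 * n%:Z)); last first.
  by rewrite exprnP -mulrA -expfzDr //; congr (_ * p ^ _); lia.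
have -> : gaussw p x (- n.+1%:Z) = gaussw p x (- n%:Z) * (p * (p ^+ 2) ^+ n / x).
  rewrite /gaussw (_ : (- n.+1%:Z) ^+ 2 = (- n%:Z) ^+ 2 + (1 + 2 * n)%N%:Z); last first.
    by rewrite !sqrrN PoszD PoszM -natz; lia.
  rewrite (expfzDr _ _ p0) -exprnP exprD expr1 exprM.
  rewrite (_ : - n.+1%:Z = - n%:Z - 1); last by lia.
  by rewrite (expfzDr _ _ x0) exprN1; ring.
have -> : p ^ (1 - 2 * n.+1%:Z) = (p * (p ^+ 2) ^+ n)^-1.
  rewrite -exprM -exprS (_ : 1 - 2 * n.+1%:Z = - (2 * n).+1%:Z); last by lia.
  by rewrite exprnN.
by rewrite exprS; field; rewrite x0 p0 !expf_neq0.
Qed.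

(** The q-binomial theorem of order 2n at y = x p^(1-2n), recentred by m = n + j. The last n factors
    of the product give (x p; p^2)_n, the first n are reflected. *)
Lemma triple_product_finite (n : nat) :
  hsum (fun j : int => (-1) ^ j * gaussw p x j * (r (n%:Z + j) * r (n%:Z - j)))
       (r n.*2 * (qpoch (x * p) (p ^+ 2) n * qpoch (p / x) (p ^+ 2) n)).
Proof.
pose h (m : nat) : int := - n%:Z + m%:Z.
have h_inj : injective h by move=> a b; rewrite /h => /addrI [].
apply: (hsum_from_inj h_inj) => [j|].
  case: (lerP 0 (n%:Z + j)) => [nj _|/(rqpoch_neg Q0 Q1) ->].
    by exists `|(n%:Z + j)%R|%N; rewrite /h; lia.
  by rewrite mul0r mulr0 eqxx.
pose y := x * p ^ (1 - 2 * n%:Z).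
have -> : r n.*2 * (qpoch (x * p) (p ^+ 2) n * qpoch (p / x) (p ^+ 2) n) =
    (-1) ^+ n * gaussw p x (- n%:Z) * (r n.*2 * qpoch y (p ^+ 2) n.*2).
  rewrite -addnn qpochD (_ : y * _ = x * p); last first.
    rewrite /y -exprM exprnP -mulrA -(expfzDr _ _ p0).
    by rewrite (_ : 1 - 2 * n%:Z + (2 * n)%N%:Z = 1) ?expr1z //; lia.
  by rewrite -gaussw_reflect /y; ring.
rewrite -q_binomial //.
have := @hsum_nat _ (fun m => (-1) ^+ m * (p ^+ 2) ^+ 'C(m, 2) * y ^+ m * r m *
   r (n.*2%:Z - m%:Z)) n.*2.+1.
move=> /(_ _)/(hsumZ ((-1) ^+ n * gaussw p x (- n%:Z))) => hs.
apply: hsum_ext (hs _) => [m|m nm]; last by rewrite rqpoch_sub_nat ?mulr0.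
rewrite /h gaussw_shift.
rewrite (_ : n%:Z + (- n%:Z + m%:Z) = m); last by lia.
rewrite (_ : n%:Z - (- n%:Z + m%:Z) = n.*2%:Z - m%:Z); last by rewrite -addnn; lia.
rewrite (expfzDr _ _ (_ : (-1 : R[i]) != 0)) ?oppr_eq0 ?oner_eq0 //.
have -> : (-1 : R[i]) ^ (- n%:Z) = (-1) ^+ n.
  by rewrite -exprnN -exprVn invrN1.
rewrite -exprnP (_ : y = x * p ^ (2 * - n%:Z) * p); last first.
  rewrite /y -mulrA -[in X in _ * (_ * X)](expr1z p) -(expfzDr _ _ p0).
  by congr (_ * p ^ _); lia.
rewrite [(x * _ * p) ^+ m]exprMn -exprM.
have -> : p ^+ (m ^ 2) = p ^+ (2 * 'C(m, 2)) * p ^+ m.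
  by rewrite -exprD -sqrn_bin2.
by ring.
Qed.

(** Limit of the finite form. The factor [H (p ^+ 2) ^+ 2] cancels the limit of
    [r (n + j) * r (n - j)], and one copy survives the limit of [r n.*2]. *)
Lemma triple_product :
  hsum (fun j : int => (-1) ^ j * gaussw p x j) (H (x * p) * H (p / x) * H (p ^+ 2)).
Proof.
have [c1 [c10 c1P]] := gaussw_bounded p1 x0.
have [c2 [c20 c2P]] := rqpoch_bounded Q0 Q1.
have HQ0 := qpoch_infty_qq_neq0 Q1.
have fs (n : nat) := hsumZ (H (p ^+ 2) ^+ 2) (@triple_product_finite n).
apply: (tannery (g := fun j => nm (H (p ^+ 2) ^+ 2) * (c1 * c2 * c2) * nm p ^+ `|j|%N) _ _ fs).
- apply: bsumZ; last by apply: bsum_geom_int; rewrite nm_ge0.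
  by rewrite mulr_ge0 ?nm_ge0 // !mulr_ge0 // ltW.
- move=> n j; rewrite -[leRHS]mulrA; apply: nm_leM => //.
  rewrite (_ : c1 * c2 * c2 * nm p ^+ `|j| = 1 * (c1 * nm p ^+ `|j|) * (c2 * c2)); last by ring.
  apply: nm_leM; last exact: nm_leM.
  by apply: nm_leM => //; rewrite nmXN1.
- move=> j; have rr : (fun n : nat => r (n%:Z + j) * r (n%:Z - j) : R[i]^o) @ \oo -->
      ((H (p ^+ 2))^-1 * (H (p ^+ 2))^-1 : R[i]^o).
    exact: cvgM (rqpoch_cvg Q0 Q1 j) (rqpoch_cvg Q0 Q1 (- j)).
  have := cvgC_mull (H (p ^+ 2) ^+ 2) (cvgC_mull ((-1) ^ j * gaussw p x j) rr).
  by move=> /cvgC_eqr; apply; field.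
- have rdbl : (fun n => r n.*2 : R[i]^o) @ \oo --> ((H (p ^+ 2))^-1 : R[i]^o).
    have := cvg_comp _ _ cvg_double (rqpoch_cvg Q0 Q1 0).
    by rewrite (_ : _ \o _ = (fun n => r n.*2)) //; apply/funext => n /=; rewrite addr0.
  have HH := cvgC_mul (qpoch_cvg (x * p) Q1) (qpoch_cvg (p / x) Q1).
  have rHH := cvgC_mul rdbl HH.
  by have /cvgC_eqr := cvgC_mull (H (p ^+ 2) ^+ 2) rHH; apply; field.
Qed.

End TripleProduct.

(** * The bilateral Bailey chain *)

Section BaileyChain.
Variables (R : realType) (q z : R[i]).
Hypotheses (q0 : q != 0) (q1 : nm q < 1) (z0 : z != 0).

Local Notation F y := (qpoch_infty y q).
Local Notation G y := (qpoch_infty y (q ^+ 2)).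
Local Notation r := (rqpoch q).
Local Notation w := (gaussw q z).

Let q2_neq0 : q ^+ 2 != 0. Proof. exact: expf_neq0. Qed.
Let q2_lt1 : nm (q ^+ 2) < 1. Proof. exact: nm_sqr_lt1. Qed.

Lemma gaussw_neq0 k : w k != 0.
Proof. by rewrite mulf_neq0 // expfz_neq0. Qed.

(* q_vandermonde with a = z q^(2j), in bilateral form *)
Lemma chain_step (n j : int) :
  hsum (fun x : int => w x * r (n - x) * (r (x - j) * F (z * q ^ (x + j + 1))))
       (w j * (r (n - j) * F (z * q ^ (n + j + 1)))).
Proof.
pose h (m : nat) : int := j + m%:Z.
have h_inj : injective h by move=> a b; rewrite /h => /addrI [].
apply: (hsum_from_inj h_inj) => [x|].
  case: (lerP 0 (x - j)) => [xj _|/(rqpoch_neg q0 q1) ->].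
    by exists `|(x - j)%R|%N; rewrite /h; lia.
  by rewrite mul0r mulr0 eqxx.
pose a := z * q ^ (2 * j).
have termE m : w (h m) * r (n - h m) * (r (h m - j) * F (z * q ^ (h m + j + 1))) =
    w j * (q ^+ (m ^ 2) * a ^+ m * r m * r (n - j - m%:Z) * F (a * q ^+ m.+1)).
  rewrite /h gaussw_shift // -/a opprD addrA.
  rewrite (_ : j + m%:Z - j = m); last by ring.
  rewrite (_ : z * q ^ (j + m%:Z + j + 1) = a * q ^+ m.+1); first by ring.
  by rewrite /a exprnP -mulrA -expfzDr //; congr (_ * q ^ _); lia.
have [nj|nj] := lerP 0 (n - j).
  have [N NE] : exists N : nat, n - j = N by exists `|(n - j)%R|%N; lia.
  have := @hsum_nat _ (fun m => q ^+ (m ^ 2) * a ^+ m * r m * r (N%:Z - m%:Z) *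
      F (a * q ^+ m.+1)) N.+1.
  rewrite q_vandermonde // => /(_ _)/(hsumZ (w j)) hs.
  rewrite NE (_ : z * q ^ (n + j + 1) = a * q ^+ N.+1).
    apply: hsum_ext (hs _) => [m|m Nm]; first by rewrite termE NE.
    by rewrite rqpoch_sub_nat // mulr0 mul0r.
  by rewrite /a exprnP -mulrA -expfzDr //; congr (_ * q ^ _); lia.
(* For [n < j] every term vanishes, and so does the right-hand side. *)
rewrite (rqpoch_neg q0 q1 nj) mul0r mulr0.
have := @hsum_nat R (fun=> 0) 0 (fun _ _ => erefl); rewrite big_geq //.
apply: hsum_ext => m; rewrite termE (rqpoch_neg q0 q1 (k := n - j - m%:Z)); first by ring.
by lia.
Qed.

(** The case of infinite [n] in [chain_step], obtained from [q_vandermonde_infty] at a = z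
    q^(2j). *)
Lemma chain_limit (j : int) :
  hsum (fun x : int => w x * (r (x - j) * F (z * q ^ (x + j + 1)))) (w j).
Proof.
pose h (m : nat) : int := j + m%:Z.
have h_inj : injective h by move=> a b; rewrite /h => /addrI [].
apply: (hsum_from_inj h_inj) => [x|].
  case: (lerP 0 (x - j)) => [xj _|/(rqpoch_neg q0 q1) ->].
    by exists `|(x - j)%R|%N; rewrite /h; lia.
  by rewrite mul0r mulr0 eqxx.
pose a := z * q ^ (2 * j).
have a0 : a != 0 by rewrite mulf_neq0 // expfz_neq0.
have := hsumZ (w j) (q_vandermonde_infty q0 q1 a0); rewrite mulr1.
apply: hsum_ext => m; rewrite /h gaussw_shift // -/a.
rewrite (_ : j + m%:Z - j = m); last by ring.
rewrite (_ : z * q ^ (j + m%:Z + j + 1) = a * q ^+ m.+1); first by ring.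
by rewrite /a exprnP -mulrA -expfzDr //; congr (_ * q ^ _); lia.
Qed.

(** Moving the argument down adds the factors 1 - u q^(-i), 0 <= i < m, and each is turned over as
    -u q^(-i) (1 - q^i / u). *)
Lemma qpoch_infty_down (u : R[i]) (m : nat) : u != 0 ->
  F (u * q * q ^- m) * q ^+ 'C(m, 2) = (- u) ^+ m * qpoch u^-1 q m * F (u * q).
Proof.
move=> u0; elim: m => [|m IHm].
  by rewrite qpoch0 bin_small // !expr0 invr1 !mulr1 mul1r.
rewrite (qpoch_inftyS (u * q * q ^- m.+1) q1) binS bin1 exprD qpochS.
have -> : u * q * q ^- m.+1 * q = u * q * q ^- m.
  by rewrite exprS; field; rewrite q0 expf_neq0.
transitivity ((1 - u * q * q ^- m.+1) * q ^+ m *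
    (F (u * q * q ^- m) * q ^+ 'C(m, 2))); first by ring.
rewrite IHm [(- u) ^+ m.+1]exprS [q ^+ m.+1]exprS; field.
by rewrite u0 q0 expf_neq0.
Qed.

(** Quasi-periodicity of the theta function. With y = z q^(2N+1), raising [N] by one multiplies the
    Gaussian and sign by -y, removes 1 - y from one product and adds 1 - 1/y to the other; and -y (1
    - 1/y) = 1 - y. *)
Lemma theta_shift (N : int) :
  (-1) ^ N * w N * (G (z * q ^ (2 * N + 1)) * G (q ^ (1 - 2 * N) / z)) =
  G (z * q) * G (q / z).
Proof.
pose f N := (-1) ^ N * w N * (G (z * q ^ (2 * N + 1)) * G (q ^ (1 - 2 * N) / z)).
have fS M : f (M + 1) = f M.
  rewrite /f; pose y := z * q ^ (2 * M + 1).
  have y0 : y != 0 by rewrite mulf_neq0 // expfz_neq0.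
  have -> : z * q ^ (2 * (M + 1) + 1) = y * q ^+ 2.
    by rewrite /y exprnP -mulrA -expfzDr //; congr (_ * q ^ _); lia.
  have -> : q ^ (1 - 2 * (M + 1)) / z = y^-1.
    by rewrite /y invfM invr_expz mulrC; congr (_ * q ^ _); lia.
  have -> : q ^ (1 - 2 * M) / z = y^-1 * q ^+ 2.
    by rewrite /y invfM invr_expz exprnP -mulrA -expfzDr // mulrC; congr (_ * q ^ _); lia.
  rewrite -/y (qpoch_inftyS y q2_lt1) (qpoch_inftyS y^-1 q2_lt1).
  have -> : w (M + 1) = w M * y.
    rewrite (gaussw_shift q0 z0 M 1) /y !expr1 (_ : q ^ (2 * M + 1) = q ^ (2 * M) * q).
      by ring.
    by rewrite expfzDr // expr1z.
  rewrite expfzDr ?oppr_eq0 ?oner_eq0 // expr1z.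
  by field.
have f0 : f 0 = G (z * q) * G (q / z).
  by rewrite /f /gaussw !expr0z mulr0 add0r subr0 !expr1z !mul1r.
rewrite -/(f N) -f0; case: N => n; elim: n => [|n IHn] //.
- by rewrite -addn1 PoszD fS.
- by rewrite -fS.
- by rewrite -IHn -fS; congr f; lia.
Qed.

(** This is [lebesgue] at 1/u, u = z q^(2N), read in the index j = N - m: [qpoch_infty_down]
    produces (1/u; q)_m from the factor F, and the signs cancel. *)
Lemma bailey_pair (N : int) : F (z * q) != 0 ->
  hsum (fun j : int => (-1) ^ j * w j * (r (N - j) * F (z * q ^ (N + j + 1))))
       (G (q / z) * F (z * q) / G q / qpoch (z * q ^+ 2) (q ^+ 2) N).
Proof.
move=> Fzq0; pose h (m : nat) : int := N - m%:Z.
have h_inj : injective h by move=> a b; rewrite /h => /addrI /oppr_inj [].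
apply: (hsum_from_inj h_inj) => [x|].
  case: (lerP 0 (N - x)) => [xj _|/(rqpoch_neg q0 q1) ->].
    by exists `|(N - x)%R|%N; rewrite /h; lia.
  by rewrite mul0r mulr0 eqxx.
pose u := z * q ^ (2 * N).
have u0 : u != 0 by rewrite mulf_neq0 // expfz_neq0.
have [Gzq0 Gzq20] : G (z * q) != 0 /\ G (z * q ^+ 2) != 0.
  move: Fzq0; rewrite qpoch_infty_double // mulf_eq0 negb_or -mulrA -expr2.
  by move=> /andP.
have Gq0 := qpoch_infty_qq2_neq0 q1.
(* Splitting [F (u * q)] by parity exposes the pair G (u q) G (q / u), which [theta_shift]
   evaluates; the other half G (u q^2) yields 1 / (z q^2; q^2)_N. *)
rewrite [X in hsum _ X](_ : _ =
    (-1) ^ N * w N * F (u * q) * (G (u^-1 * q) / G q)); last first.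
  rewrite qpoch_inv // !(qpoch_infty_double (_ * q) q1).
  rewrite (_ : z * q * q = z * q ^+ 2); last by rewrite expr2 mulrA.
  rewrite (_ : z * q ^+ 2 * (q ^+ 2) ^ N = u * q * q); last first.
    by rewrite (_ : (q ^+ 2) ^ N = q ^ (2 * N)) ?exprnP ?exprz_exp // /u -exprnP expr2; ring.
  have := theta_shift N.
  rewrite (_ : z * q ^ (2 * N + 1) = u * q); last by rewrite expfzDr // expr1z mulrA.
  rewrite (_ : q ^ (1 - 2 * N) / z = u^-1 * q); last first.
    by rewrite /u invfM invr_expz expfzDr // expr1z; ring.
  move=> th; transitivity (G (u * q * q) / G q * (G (z * q) * G (q / z))).
    by field; rewrite Gq0.
  by rewrite -th; ring.
apply: hsum_ext (hsumZ ((-1) ^ N * w N * F (u * q))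
  (@lebesgue R q q0 q1 u^-1)) => m.
rewrite /h /lebesgue_term.
rewrite (_ : N - (N - m%:Z) = m); last by ring.
(* [gaussw_shift] is to be applied from N - m up to N, so [u] is first expressed through the
   parameter z q^(2(N-m)). *)
have uE : u ^+ m = (z * q ^ (2 * (N - m%:Z))) ^+ m * q ^+ (m ^ 2) * q ^+ (m ^ 2).
  rewrite /u !exprMn -!mulrA; congr (z ^+ m * _).
  rewrite !(exprnP (_ ^ _)) !exprz_exp !(exprnP q) -!expfzDr //; congr (q ^ _).
  by rewrite -mulnn PoszM; ring.
have wE : w (N - m%:Z) * u ^+ m = w N * q ^+ (m ^ 2).
  by rewrite uE -[in w N](subrK m%:Z N) gaussw_shift //; ring.
have {}wE : w (N - m%:Z) = w N * q ^+ (m ^ 2) / u ^+ m.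
  by rewrite -wE mulfK // expf_neq0.
have -> : F (z * q ^ (N + (N - m%:Z) + 1)) =
    (- u) ^+ m * qpoch u^-1 q m * F (u * q) / q ^+ 'C(m, 2).
  rewrite -qpoch_infty_down // mulfK ?expf_neq0 //; congr (F _).
  rewrite (_ : N + (N - m%:Z) + 1 = 2 * N + 1 - m%:Z); last by ring.
  by rewrite !expfzDr // expr1z -exprnN /u !mulrA.
rewrite wE expfzDr ?oppr_eq0 ?oner_eq0 // -exprnN (exprNn u).
have -> : (-1 : R[i]) ^- m = (-1) ^+ m by rewrite -exprVn invrN1.
have -> : q ^+ (m ^ 2) = q ^+ 'C(m.+1, 2) * q ^+ 'C(m, 2).
  by rewrite -exprD -sqrn_bin2S.
transitivity (((-1) ^+ m * (-1) ^+ m) * ((-1) ^ N * w N * F (u * q) *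
    (q ^+ 'C(m.+1, 2) * r m * qpoch u^-1 q m))).
  by rewrite -exprMn mulrNN mulr1 expr1n mul1r.
by field; rewrite !expf_neq0.
Qed.

(** The square root matches the case k = j = -a of [pair_bounded]: the exponent left there, 2 a^2 -
    C(2a, 2), is only a = (|k| + |j|) / 2. *)
Let rho := Num.sqrt (nm q).

Lemma rho_sqr : rho ^+ 2 = nm q.
Proof. by rewrite sqr_sqrtr // nm_ge0. Qed.

Lemma rho_gt0 : 0 < rho.
Proof. by rewrite sqrtr_gt0 nm_gt0. Qed.

Lemma rho_lt1 : rho < 1.
Proof. by rewrite -sqrtr1 ltr_sqrt. Qed.

Lemma gaussw_rho_bounded : exists c : R, 0 < c /\
  forall k : int, nm (w k) <= c * rho ^+ `|k|%N.
Proof.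
have r0 := ltW rho_gt0; have r1 := ltW rho_lt1.
have [c [c0 cP]] := gaussw_bounded q1 z0; exists c; split=> // k.
apply: (le_trans (cP k)); rewrite ler_wpM2l ?(ltW c0) //.
by rewrite lerXn2r ?nnegrE ?nm_ge0 // -rho_sqr expr2 ler_piMl.
Qed.

(* For k + j < 0 the factor F grows like |z|^(-k-j) |q|^(-C(|k+j|, 2)), which is
   absorbed by w k * w j thanks to absz_gauss_exponent. *)
Lemma pair_bounded : exists c : R, 0 < c /\ forall k j : int,
  nm (w k * w j * F (z * q ^ (k + j + 1))) <= c * (rho ^+ `|k|%N * rho ^+ `|j|%N).
Proof.
have r0 := rho_gt0; have r1 := rho_lt1; have nq0 := nm_ge0 q.
have [c1 [c10 c1r]] := gaussw_rho_bounded.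
have [c3 [c30 c3P]] := cvg_bounded (qpoch_infty_cvg1 (z * q) q1).
have [c5 [c50 c5P]] := cvg_bounded (qpoch_cvg z^-1 q1).
have Cge : 0 <= c1 * c1 * c3 by rewrite !mulr_ge0 // ltW.
have Dge : 0 <= c5 * nm (F (z * q)) by rewrite mulr_ge0 ?nm_ge0 // ltW.
exists (c1 * c1 * c3 + c5 * nm (F (z * q)) + 1); split=> [|k j].
  by rewrite ltr_wpDl // addr_ge0.
have X0 : 0 <= rho ^+ `|k|%N * rho ^+ `|j|%N by rewrite mulr_ge0 ?exprn_ge0 // ltW.
have [kj|kj] := lerP 0 (k + j).
  apply: (@le_trans _ _ (c1 * c1 * c3 * (rho ^+ `|k|%N * rho ^+ `|j|%N))); last first.
    by rewrite ler_wpM2r // -addrA lerDl addr_ge0.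
  rewrite (_ : c1 * c1 * c3 * _ = (c1 * rho ^+ `|k|%N) * (c1 * rho ^+ `|j|%N) * c3); last by ring.
  apply: nm_leM; first exact: nm_leM.
  have -> : z * q ^ (k + j + 1) = z * q * q ^+ `|(k + j)%R|%N; last exact: c3P.
  rewrite exprnP gez0_abs // expfzDr // expr1z; ring.
apply: (@le_trans _ _ (c5 * nm (F (z * q)) * (rho ^+ `|k|%N * rho ^+ `|j|%N))); last first.
  by rewrite ler_wpM2r // addrAC lerDr addr_ge0.
pose n := `|(k + j)%R|%N.
have kjE : k + j = - n%:Z by rewrite /n ltz0_abs // opprK.
have down := qpoch_infty_down n z0.
have q2C : 0 < nm q ^+ 'C(n, 2) by rewrite exprn_gt0 // nm_gt0.
rewrite -(ler_pM2r q2C) -[in leLHS]nmX -nmM.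
have -> : z * q ^ (k + j + 1) = z * q * q ^- n.
  by rewrite kjE expfzDr // expr1z -exprnN; ring.
rewrite -[_ * _ * q ^+ _]mulrA down.
have -> : w k * w j * ((- z) ^+ n * qpoch z^-1 q n * F (z * q)) =
    q ^+ (`|k| ^ 2 + `|j| ^ 2) * (-1) ^+ n * (qpoch z^-1 q n * F (z * q)).
  have zz : z ^ k * z ^ j * z ^+ n = 1.
    by rewrite -expfzDr // kjE -exprnN mulVf // expf_neq0.
  rewrite /gaussw (exprNn z) exprD.
  have sq (i : int) : q ^ (i ^+ 2) = q ^+ (`|i| ^ 2).
    by rewrite sqrz_absz.
  rewrite !sq; set A := q ^+ _; set B := q ^+ (`|j| ^ 2).
  transitivity (z ^ k * z ^ j * z ^+ n * (A * B * (-1) ^+ n * (qpoch z^-1 q n * F (z * q)))).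
    by ring.
  by rewrite zz mul1r.
rewrite [leRHS](_ : _ = (rho ^+ `|k|%N * rho ^+ `|j|%N * nm q ^+ 'C(n, 2)) *
  (c5 * nm (F (z * q)))); last by ring.
apply: nm_leM; last first.
  by apply: nm_leM => //; exact: c5P.
rewrite nmM !nmX nmN nm1 expr1n mulr1 -!rho_sqr -!exprM -exprD -exprD.
apply: ler_wiXn2l; rewrite ?(ltW r0) ?(ltW r1) //.
by rewrite addnC addnA; exact: absz_gauss_exponent.
Qed.

(** The summand of the theorem without its factor in k_(r-1), for r = n + 2 and with entries
    numbered from 0. *)
Definition chain_weight (n : nat) (k : seq int) : R[i] :=
  (\prod_(0 <= i < n.+1) w k`_i) * \prod_(0 <= i < n) r (k`_i - k`_i.+1).

(** The weight linked to [j] by the kernel of [bailey_pair]: summation over [j] restores the missing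
    factor, summation over [k] runs down the chain. *)
Definition chain_term (n : nat) (k : seq int) (j : int) : R[i] :=
  chain_weight n k * (r (k`_n - j) * F (z * q ^ (k`_n + j + 1))).

Lemma nm_prod_le (I : Type) (s : seq I) (f : I -> R[i]) (g : I -> R) :
  (forall i, nm (f i) <= g i) -> nm (\prod_(i <- s) f i) <= \prod_(i <- s) g i.
Proof.
move=> fg; elim: s => [|i s IHs]; first by rewrite !big_nil nm1.
by rewrite !big_cons; exact: nm_leM.
Qed.

(** The factor F may be large when the last entry plus [j] is very negative, so it is bounded
    jointly with [w j] and the last Gaussian by [pair_bounded]; the other factors are bounded one by
    one. *)
Lemma chain_term_bounded n : exists c : R, 0 < c /\
  forall (k : n.+1.-tuple int) (j : int),
  nm (w j * chain_term n k j) <= c * (\prod_(x <- k) rho ^+ `|x|%N * rho ^+ `|j|%N).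
Proof.
have r0 := rho_gt0; have r1 := rho_lt1; have nq0 := nm_ge0 q.
have [c1 [c10 c1r]] := gaussw_rho_bounded.
have [c2 [c20 c2P]] := rqpoch_bounded q0 q1.
have [c3 [c30 c3P]] := pair_bounded.
exists (c1 ^+ n * c2 ^+ n * c2 * c3); split=> [|k j].
  by rewrite !mulr_gt0 ?exprn_gt0.
rewrite (big_nth 0) size_tuple big_nat_recr //=.
set P := \prod_(0 <= i < n) _; set x := k`_n.
have -> : w j * chain_term n k j = (\prod_(0 <= i < n) w k`_i) *
    (\prod_(0 <= i < n) r (k`_i - k`_i.+1)) * r (x - j) *
    (w x * w j * F (z * q ^ (x + j + 1))).
  by rewrite /chain_term /chain_weight big_nat_recr //= -/x; ring.
have -> : c1 ^+ n * c2 ^+ n * c2 * c3 * (P * rho ^+ `|x| * rho ^+ `|j|) =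
    (c1 ^+ n * P) * c2 ^+ n * c2 * (c3 * (rho ^+ `|x| * rho ^+ `|j|)) by ring.
apply: nm_leM => //; apply: nm_leM => //; apply: nm_leM.
  apply: (le_trans (nm_prod_le _ (fun i => c1r k`_i))).
  by rewrite big_split /= big_const_nat subn0 iter_mulr_1.
apply: (le_trans (nm_prod_le _ (fun i => c2P (k`_i - k`_i.+1)))).
by rewrite big_const_nat subn0 iter_mulr_1.
Qed.

Lemma rcons_tuple_inj n :
  injective (fun p : n.-tuple int * int => [tuple of rcons p.1 p.2]).
Proof.
move=> [k x] [k' x'] /(congr1 val) /= /rcons_inj [kk' ->].
by rewrite (val_inj kk').
Qed.

(** By induction on the length: [chain_step] sums over the last entry and releases one factor [w j],
    and [chain_limit] treats the only entry left. *)
Lemma chain_sum n (j : int) :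
  hsum (fun k : n.+1.-tuple int => chain_term n k j) (w j ^+ n.+1).
Proof.
elim: n => [|n IHn].
  have h_inj : injective (fun x : int => [tuple x]) by move=> x y [].
  apply: (hsum_from_inj h_inj) => [k _|].
    by exists (thead k); rewrite [LHS]tuple_eta; apply: val_inj => /=; case: k => -[|? []].
  rewrite expr1; apply: hsum_ext (@chain_limit j) => x.
  by rewrite /chain_term /chain_weight big_nat1 big_geq //= mulr1.
apply: (hsum_from_inj (@rcons_tuple_inj n.+1)) => [k _|].
  case: k => s ss; case: (lastP s) ss => [//|s' x] ss.
  have ss' : size s' == n.+1 by move: ss; rewrite size_rcons eqSS.
  by exists (Tuple ss', x); apply: val_inj.
have [c [c0 cP]] := chain_term_bounded n.+1.
have wj0 : 0 < nm (w j) by rewrite nm_gt0 gaussw_neq0.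
have termE (k : n.+1.-tuple int) x : chain_term n.+1 (rcons k x) j =
    chain_weight n k * (w x * r (k`_n - x) * (r (x - j) * F (z * q ^ (x + j + 1)))).
  have kn i : (i < n.+1)%N -> (rcons k x)`_i = k`_i.
    by move=> ni; rewrite nth_rcons size_tuple ni.
  have kx : (rcons k x)`_n.+1 = x by rewrite nth_rcons size_tuple ltnn eqxx.
  have prodw : \prod_(0 <= i < n.+2) w (rcons k x)`_i =
      (\prod_(0 <= i < n.+1) w k`_i) * w x.
    rewrite big_nat_recr //= kx; congr (_ * _).
    by apply: eq_big_nat => i /andP[_ ni]; rewrite kn.
  have prodr : \prod_(0 <= i < n.+1) r ((rcons k x)`_i - (rcons k x)`_i.+1) =
      (\prod_(0 <= i < n) r (k`_i - k`_i.+1)) * r (k`_n - x).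
    rewrite big_nat_recr //= kx kn //; congr (_ * _).
    by apply: eq_big_nat => i /andP[_ ni]; rewrite !kn // ltnW.
  by rewrite /chain_term /chain_weight prodw prodr kx; ring.
(* Since [j] is fixed, the bound for [w j] times the term may be divided by the nonzero |w j|. *)
apply: (@fubini_total _ _ _ _ (fun k : n.+1.-tuple int => w j * chain_term n k j)
  (fun p : n.+1.-tuple int * int => c * rho ^+ `|j|%N / nm (w j) *
    \prod_(x <- [tuple of rcons p.1 p.2]) rho ^+ `|x|%N)).
- apply: bsumZ.
    by rewrite !mulr_ge0 ?exprn_ge0 ?invr_ge0 ?(ltW c0) ?(ltW wj0) ?(ltW rho_gt0).
  apply: (bsum_inj (@rcons_tuple_inj n.+1)
    (g := fun k : n.+2.-tuple int => \prod_(x <- k) rho ^+ `|x|%N)).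
  by apply: bsum_geom_tuple; rewrite ltW ?rho_gt0 ?rho_lt1.
- move=> p; have := cP [tuple of rcons p.1 p.2] j; rewrite nmM mulrC.
  rewrite -ler_pdivlMr // => h; apply: (le_trans h).
  by rewrite le_eqVlt; apply/orP; left; apply/eqP; field; rewrite gt_eqF.
- move=> k; have := hsumZ (chain_weight n k) (@chain_step k`_n j).
  rewrite (_ : _ * (w j * _) = w j * chain_term n k j); last by rewrite /chain_term; ring.
  by apply: hsum_ext => x; rewrite -termE.
by rewrite exprS; exact: hsumZ.
Qed.

(** One dominated double sum over [j] and [k] is evaluated twice: over [k] first it becomes the
    theta series, over [j] first [bailey_pair] turns it into a constant times the multisum. *)
Lemma multisum n : F (z * q) != 0 -> G (q / z) != 0 ->
  hsum (fun k : n.+1.-tuple int => chain_weight n k / qpoch (z * q ^+ 2) (q ^+ 2) k`_n)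
    (G q * qpochs_infty [:: z ^+ n.+2 * q ^+ n.+2; z ^- n.+2 * q ^+ n.+2; q ^+ (2 * n.+2)]
             (q ^+ (2 * n.+2)) / (F (z * q) * G (q / z))).
Proof.
move=> Fzq0 Gqz0; have Gq0 := qpoch_infty_qq2_neq0 q1.
(* (w j)^r is again a Gaussian, with q^r and z^r in place of q and z, so the triple product applies
   in base q^(2r). *)
set theta := qpochs_infty _ _.
have theta_sum : hsum (fun j : int => (-1) ^ j * w j ^+ n.+2) theta.
  have p0 : q ^+ n.+2 != 0 by exact: expf_neq0.
  have p1 : nm (q ^+ n.+2) < 1 by rewrite nmX exprn_ilt1 ?nm_ge0.
  have x0 : z ^+ n.+2 != 0 by exact: expf_neq0.
  have := triple_product p0 p1 x0.
  rewrite -exprM [(n.+2 * 2)%N]mulnC.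
  rewrite (_ : _ * _ * _ = theta); last first.
    by rewrite /theta /qpochs_infty !big_cons big_nil mulr1 mulrA (mulrC (z ^- _)).
  apply: hsum_ext => j; congr (_ * _); rewrite /gaussw exprMn !exprnP !exprz_exp.
  by rewrite ![n.+2%:Z * _]mulrC.
have [c [c0 cP]] := chain_term_bounded n.
have total : hsum (fun p : int * n.+1.-tuple int =>
    (-1) ^ p.1 * (w p.1 * chain_term n p.2 p.1)) theta.
  apply: (@fubini_total _ _ _ _ (fun j => (-1) ^ j * w j ^+ n.+2)
    (fun p : int * n.+1.-tuple int => c * (rho ^+ `|p.1|%N * \prod_(x <- p.2) rho ^+ `|x|%N))
    _ _ _ _ theta_sum).
  - apply: bsumZ; first exact: ltW.
    have rho01 : 0 <= rho < 1 by rewrite ltW ?rho_gt0 ?rho_lt1.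
    apply: (@bsum_prod _ _ _ (fun j : int => rho ^+ `|j|%N)
      (fun k : n.+1.-tuple int => \prod_(x <- k) rho ^+ `|x|%N)).
    + by move=> j; rewrite exprn_ge0 // ltW ?rho_gt0.
    + by move=> k; apply: prodr_ge0 => x _; rewrite exprn_ge0 // ltW ?rho_gt0.
    + exact: bsum_geom_int.
    + exact: bsum_geom_tuple.
  - by move=> [j k]; rewrite nmM nmXN1 mul1r [rho ^+ _ * _]mulrC; exact: cP.
  - move=> j /=; have := hsumZ ((-1) ^ j) (hsumZ (w j) (@chain_sum n j)).
    by rewrite -exprS.
pose swap (p : n.+1.-tuple int * int) := (p.2, p.1).
have swap_inj : injective swap by move=> [a b] [a' b'] [-> ->].
have {}total : hsum (fun p : n.+1.-tuple int * int =>
    (-1) ^ p.2 * (w p.2 * chain_term n p.1 p.2)) theta.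
  apply: ((hsum_inj theta swap_inj _).1 total) => -[j k] _.
  by exists (k, j).
have inner (k : n.+1.-tuple int) := hsumZ (chain_weight n k) (@bailey_pair k`_n Fzq0).
have := fubini_outer total (g := fun k : n.+1.-tuple int => chain_weight n k *
  (G (q / z) * F (z * q) / G q / qpoch (z * q ^+ 2) (q ^+ 2) k`_n)) _.
move=> /(_ _)/(hsumZ (G q / (G (q / z) * F (z * q)))) hs.
rewrite (_ : G q * theta / _ = G q / (G (q / z) * F (z * q)) * theta); last first.
  by rewrite [F _ * _]mulrC mulrAC.
apply: hsum_ext (hs _) => [k|k].
  have cancel (a b d x : R[i]) : a != 0 -> b != 0 -> a / b * (d * (b / a * x)) = d * x.
    by move=> a0 b0; field; rewrite a0 b0.
  exact: (cancel _ _ _ _ Gq0 (mulf_neq0 Gqz0 Fzq0)).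
by apply: hsum_ext (inner k) => j /=; rewrite /chain_term; ring.
Qed.

End BaileyChain.

(** * Summation over ordered tuples *)

Section Lambda.
Variable R : realType.
Implicit Types q z : R[i].

Lemma exprz_sum q (I : Type) (s : seq I) (e : I -> int) : q != 0 ->
  q ^ (\sum_(i <- s) e i) = \prod_(i <- s) q ^ e i.
Proof.
move=> q0; elim: s => [|i s IHs]; first by rewrite !big_nil expr0z.
by rewrite !big_cons expfzDr // IHs.
Qed.

Lemma chain_weightE q z n (k : Lambda n.+1) : q != 0 -> nm q < 1 -> z != 0 ->
  q ^ (\sum_(1 <= j < n.+2) entry k j ^+ 2) * z ^ (\sum_(1 <= j < n.+2) entry k j)
    / (qpoch (z * q ^+ 2) (q ^+ 2) (entry k n.+1)
       * \prod_(1 <= j < n.+1) qpoch q q (entry k j - entry k j.+1)) =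
  chain_weight q z n (val k) / qpoch (z * q ^+ 2) (q ^+ 2) (val k)`_n.
Proof.
move=> q0 q1 z0; rewrite !big_add1 /= !exprz_sum // -big_split /= invfM.
rewrite [X in _ * X = _]mulrC mulrA; congr (_ * _); congr (_ * _).
by rewrite -prodfV; apply: eq_bigr => i _; rewrite rqpochE.
Qed.

(** An ascent between neighbouring entries makes one reciprocal vanish by [rqpoch_neg]; hence a sum
    over all tuples is a sum over [Lambda]. *)
Lemma chain_weight_sorted q z n (k : n.+1.-tuple int) : q != 0 -> nm q < 1 ->
  chain_weight q z n k != 0 -> sorted >=%R k.
Proof.
move=> q0 q1; rewrite mulf_eq0 negb_or => /andP[_ rk].
apply/(sortedP 0) => i; rewrite size_tuple ltnS => ni.
have {rk} : rqpoch q (k`_i - k`_i.+1) != 0.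
  apply: contraNneq rk => ri; rewrite (big_rem i) ?mem_index_iota //=.
  by rewrite ri mul0r.
apply: contraNT; rewrite -ltNge => lti; rewrite (rqpoch_neg q0 q1) //.
by rewrite subr_lt0.
Qed.

Lemma multisum_Lambda q z n : q != 0 -> nm q < 1 -> z != 0 ->
  qpoch_infty (z * q) q != 0 -> qpoch_infty (q / z) (q ^+ 2) != 0 ->
  hsum (fun k : Lambda n.+1 =>
    q ^ (\sum_(1 <= j < n.+2) entry k j ^+ 2) * z ^ (\sum_(1 <= j < n.+2) entry k j)
      / (qpoch (z * q ^+ 2) (q ^+ 2) (entry k n.+1)
         * \prod_(1 <= j < n.+1) qpoch q q (entry k j - entry k j.+1)))
    (qpoch_infty q (q ^+ 2)
     * qpochs_infty [:: z ^+ n.+2 * q ^+ n.+2; z ^- n.+2 * q ^+ n.+2; q ^+ (2 * n.+2)]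
         (q ^+ (2 * n.+2))
     / (qpoch_infty (z * q) q * qpoch_infty (q / z) (q ^+ 2))).
Proof.
move=> q0 q1 z0 h1 h2; have := multisum q0 q1 z0 h1 h2 (n := n).
move=> /(@hsum_inj _ (Lambda n.+1) _ val _ _ val_inj) hs.
apply: hsum_ext (hs _) => [k|k]; first by rewrite chain_weightE.
rewrite mulf_eq0 negb_or => /andP[/(chain_weight_sorted q0 q1) sk _].
by exists (exist _ k sk).
Qed.

(** Both sides are 1: [0 ^ e] is 0 unless [e = 0], and a zero sum of squares forces all entries to
    be 0, so only the zero tuple contributes. *)
Lemma multisum_Lambda_q0 z n :
  hsum (fun k : Lambda n.+1 =>
    0 ^ (\sum_(1 <= j < n.+2) entry k j ^+ 2) * z ^ (\sum_(1 <= j < n.+2) entry k j)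
      / (qpoch (z * 0 ^+ 2) (0 ^+ 2) (entry k n.+1)
         * \prod_(1 <= j < n.+1) qpoch 0 0 (entry k j - entry k j.+1)))
    (qpoch_infty 0 (0 ^+ 2)
     * qpochs_infty [:: z ^+ n.+2 * 0 ^+ n.+2; z ^- n.+2 * 0 ^+ n.+2; 0 ^+ (2 * n.+2)]
         (0 ^+ (2 * n.+2))
     / (qpoch_infty (z * 0) 0 * qpoch_infty (0 / z) (0 ^+ 2))).
Proof.
have n0 : nm (0 : R[i]) < 1 by rewrite nm0.
rewrite /qpochs_infty !big_cons big_nil !expr0n /= !mulr0 mul0r.
rewrite !qpoch_infty0 // !mulr1 invr1 mulr1.
pose t0 : n.+1.-tuple int := [tuple of nseq n.+1 0].
have st0 : sorted >=%R t0 by apply/(sortedP 0) => i _; rewrite !nth_nseq !if_same.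
pose k0 : Lambda n.+1 := exist _ t0 st0.
have e0 j : entry k0 j = 0 by rewrite /entry nth_nseq if_same.
set f := fun k : Lambda n.+1 => _.
have <- : \sum_(k <- [fset k0]%fset) f k = 1.
  rewrite big_seq_fset1 /f.
  rewrite !big1 => [|j _|j _|j _]; rewrite ?e0 ?expr0n ?subrr ?qpoch0 //.
  by rewrite !expr0z !mulr1 invr1 mulr1.
apply: hsum_fin => k; rewrite inE => /negP kk0; rewrite /f exp0rz.
case: eqP => [s0|]; last by rewrite !mul0r.
case: kk0; apply/eqP/val_inj/val_inj => /=; rewrite -[0 :: nseq n 0]/(nseq n.+1 0).
apply: (@eq_from_nth _ 0).
  by rewrite size_tuple size_nseq.
move=> i; rewrite size_tuple => ni; rewrite nth_nseq if_same.
have /eqP := s0; rewrite big_add1 /= big_mkord psumr_eq0 => [/allP/(_ (Ordinal ni))|j _].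
  by rewrite mem_index_enum => /(_ isT); rewrite sqrf_eq0 => /eqP.
exact: sqr_ge0.
Qed.

End Lambda.

Theorem theorem4p10 (R : realType) (r : nat) (q z : R[i])
  (hr : (2 <= r)%N) (hq : `|q| < 1) (hz : z != 0)
  (hden_sum : forall n : nat, qpoch (z * q ^+ 2) (q ^+ 2) n != 0)
  (hden1 : qpoch_infty (z * q) q != 0)
  (hden2 : qpoch_infty (q / z) (q ^+ 2) != 0) :
  partial_sum (fun k : Lambda r.-1 =>
      (q ^ (\sum_(1 <= j < r) entry k j ^+ 2) * z ^ (\sum_(1 <= j < r) entry k j)
       / (qpoch (z * q ^+ 2) (q ^+ 2) (entry k r.-1)
          * \prod_(1 <= j < r.-1) qpoch q q (entry k j - entry k j.+1))) : R[i]^o)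
    @ totally
  --> (qpoch_infty q (q ^+ 2)
       * qpochs_infty [:: z ^+ r * q ^+ r; z ^- r * q ^+ r; q ^+ (2 * r)]
           (q ^+ (2 * r))
       / (qpoch_infty (z * q) q * qpoch_infty (q / z) (q ^+ 2)) : R[i]^o).
Proof.
have q1 : nm q < 1 by move: hq; rewrite nmE ltcE /= => /andP[].
case: r hr => [//|[//|n]] _.
(* The chain works with negative powers of [q], hence the separate case [q = 0]. *)
have [qE|q0] := eqVneq q 0; first by subst q; exact: multisum_Lambda_q0.
exact: multisum_Lambda.
Qed.
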